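(* Let $H=(H_i)_{i\in\mathbb I}$ be a family of continuous Hamiltonians on $\mathbb T^n\times\mathbb R^n\times\mathbb R^m$ that is coercive, convex and monotone, with Lagrangian $L=(L_i)_{i\in\mathbb I}$. Let $(z,k,\lambda)\in\mathbb T^n\times\mathbb I\times(0,\infty)$ and let $v^\lambda$ be the solution of $(P_\lambda)$. Assume that, for some constant $C>0$, \[ |v^\lambda(x)|+|Dv^\lambda(x)|\le C\quad\text{for a.e. }x\in\mathbb T^n . \] Let $Q$ be a compact convex subset of $\mathbb R^{n+m}$ such that for all $(x,i,p,u)\in\mathbb T^n\times\mathbb I\times\mathbb R^{n}\times\mathbb R^m$, \[ \partial_{(p,u)}H_i(x,p,u)\subset Q\quad\text{if }|p|+|u|\le C . \] Assume that there exists $\mu=(\mu_i)_{i\in\mathbb I}\in\mathfrak C(z,k,\lambda)$ such that $v_k^\lambda(z)=\langle\mu,L\rangle$. Then \[ \operatorname{supp}\mu_i\subset\mathbb T^n\times[Q\cap(\mathbb R^n\times Y_i)]\quad\text{for all }i\in\mathbb I . \]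
   Context: $n,m\in\mathbb N$; $\mathbb T^n$ is the $n$-dimensional flat torus; $\mathbb I=\{1,\dots,m\}$; each $H_i:\mathbb T^n\times\mathbb R^n\times\mathbb R^m\to\mathbb R$ is continuous; $B_R^m$ is the open ball in $\mathbb R^m$ with center at the origin and radius $R$; $\mathbf 1=(1,\dots,1)\in\mathbb R^m$; $|\cdot|$ denotes Euclidean norms. $\partial_{(p,u)}H_i(x,p,u)\subset\mathbb R^{n+m}$ is the subdifferential at $(p,u)$ of the convex function $(p,u)\mapsto H_i(x,p,u)$. For $\lambda>0$, $(P_\lambda)$ is the system $\lambda v_i(x)+H_i(x,Dv_i(x),v(x))=0$ in $\mathbb T^n$, $i\in\mathbb I$, for $v=(v_i)_{i\in\mathbb I}:\mathbb T^n\to\mathbb R^m$. Solutions are in the viscosity sense: a continuous $v$ is a subsolution (resp. supersolution) if whenever $i\in\mathbb I$, $\varphi\in C^1(\mathbb T^n)$ and $v_i-\varphi$ has a maximum (resp. minimum) at $x$, then $\lambda v_i(x)+H_i(x,D\varphi(x),v(x))\le 0$ (resp. $\ge 0$); a solution is both. Coercive: for any $i\in\mathbb I$ and $R>0$, $\lim_{|p|\to\infty}\inf_{(x,u)\in\mathbb T^n\times B_R^m}H_i(x,p,u)=\infty$. Convex: for any $(x,i)$, $(p,u)\mapsto H_i(x,p,u)$ is convex on $\mathbb R^n\times\mathbb R^m$. Monotone: for any $(x,p)$ and $u,v\in\mathbb R^m$, if $u_k-v_k=\max_{i\in\mathbb I}(u_i-v_i)\ge 0$, then $H_k(x,p,u)\ge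 H_k(x,p,v)$. It is well known that if $H$ is coercive and monotone and $\lambda>0$, then $(P_\lambda)$ has a unique continuous solution, and it is Lipschitz continuous. Lagrangian: $L_i(x,\xi,\eta)=\sup_{(p,u)\in\mathbb R^n\times\mathbb R^m}[\xi\cdot p+\eta\cdot u-H_i(x,p,u)]\in(-\infty,\infty]$. Also $Y_k=\{\eta=(\eta_i)_{i\in\mathbb I}\in\mathbb R^m : \eta_i\le 0\text{ if }i\ne k,\ \sum_{i\in\mathbb I}\eta_i\ge 0\}$ for $k\in\mathbb I$. Measures: $\mathbb M_+(X)$ is the set of nonnegative finite Borel measures on $X$. For $\mu=(\mu_i)_{i\in\mathbb I}\in\mathbb M_+(\mathbb T^n\times\mathbb R^n\times\mathbb R^m)^m$ and $\phi=(\phi_i)_{i\in\mathbb I}$, $\langle\mu,\phi\rangle=\sum_{i\in\mathbb I}\langle\mu_i,\phi_i\rangle=\sum_{i\in\mathbb I}\int\phi_i(x,\xi,\eta)\,\mu_i(dx\,d\xi\,d\eta)$; $\langle\mu,L\rangle\in(-\infty,\infty]$ is well defined since each $L_i$ is lower semicontinuous and bounded below. For $\lambda>0$ put $S^\lambda(\eta)=\lambda+\sum_{i\in\mathbb I}\eta_i$, and let $\mathbb P^\lambda$ be the set of all $\mu\in\mathbb M_+(\mathbb T^n\times\mathbb R^n\times\mathbb R^m)^m$ with $\langle\mu_i,|\xi|+|\eta|\rangle<\infty$ for all $i\in\mathbb I$ and $\langle\mu,S^\lambda\mathbf 1\rangle=1$. $\mathfrak C(z,k,\lambda)$ is the set of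 all $\mu\in\mathbb P^\lambda$ such that \[ \langle\mu,\xi\cdot D\psi+\eta\cdot\psi\,\mathbf 1+\lambda\psi\rangle=\psi_k(z)\quad\text{for all }\psi=(\psi_i)_{i\in\mathbb I}\in C^1(\mathbb T^n)^m, \] where the $i$-th component of the integrand is $\xi\cdot D\psi_i(x)+\eta\cdot\psi(x)+\lambda\psi_i(x)$. *)

(* Defs.v *)
From HB Require Import structures.
From mathcomp Require Import all_boot all_order all_algebra.
From mathcomp Require Import all_classical all_reals all_analysis.

Set Implicit Arguments.
Unset Strict Implicit.
Unset Printing Implicit Defensive.

Import Order.TTheory GRing.Theory Num.Theory.
Import numFieldNormedType.Exports.

Local Open Scope classical_set_scope.
Local Open Scope ring_scope.
Local Open Scope quotient_scope.

Section Euclidean.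
Variable R : realType.

Definition dotp d (a b : 'rV[R]_d) : R := \sum_j a 0 j * b 0 j.

(* The library norm on matrices is the sup norm, hence a separate definition.
   On matrices this is the Frobenius norm. *)
Definition enorm p q (A : 'M[R]_(p, q)) : R :=
  Num.sqrt (\sum_i \sum_j A i j ^+ 2).

(* Partial derivatives; meaningful at points where f is differentiable. *)
Definition grad d (f : 'rV[R]_d -> R) (y : 'rV[R]_d) : 'rV[R]_d :=
  \row_j 'D_(delta_mx 0 j) f y.

(* Lebesgue outer measure on R^d. Each box is given by its corners c.1 <= c.2
   and degenerate boxes are allowed, so finite covers are included if d > 0. *)
Definition box d (c : 'rV[R]_d * 'rV[R]_d) : set 'rV[R]_d :=
  [set y | forall j, c.1 0 j <= y 0 j <= c.2 0 j].

Definition box_volume d (c : 'rV[R]_d * 'rV[R]_d) : R :=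
  \prod_j (c.2 0 j - c.1 0 j).

Definition lebesgue_outer d (A : set 'rV[R]_d) : \bar R :=
  ereal_inf [set (\sum_(0 <= k <oo) (box_volume (c k))%:E)%E
            | c in [set c : nat -> 'rV[R]_d * 'rV[R]_d |
                    (forall k j, (c k).1 0 j <= (c k).2 0 j) /\
                    A `<=` \bigcup_k box (c k)]].

End Euclidean.

Section Torus.
Variables (R : realType) (n : nat).

Definition lattice_eq (x y : 'rV[R]_n) : bool :=
  [forall j, x 0 j - y 0 j \is a Num.int].

Lemma lattice_eq_equiv : equiv_class_of lattice_eq.
Proof.
split=> [x|x y|y x z].
- by apply/forallP => j; rewrite subrr rpred0.
- by apply/forallP/forallP => h j; rewrite -opprB rpredN.
- move=> /forallP xy /forallP yz; apply/forallP => j.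
  by rewrite -(subrKA (y 0 j)) rpredD.
Qed.

Canonical lattice_eq_equiv_rel := EquivRelPack lattice_eq_equiv.

(* R^n / Z^n with the quotient topology. *)
Definition torus : Type := quotient_topology {eq_quot lattice_eq}.

HB.instance Definition _ :=
  Quotient.copy torus (quotient_topology {eq_quot lattice_eq}).
HB.instance Definition _ :=
  PointedTopological.copy torus (quotient_topology {eq_quot lattice_eq}).

(* The Z^n-periodic function on R^n corresponding to a function on the torus. *)
Definition tlift (T : Type) (f : torus -> T) : 'rV[R]_n -> T :=
  fun y => f (\pi_torus y).

(* The gradient of [tlift f] is Z^n-periodic, so that the choice of the
   representative is irrelevant. *)
Definition tgrad (f : torus -> R) (x : torus) : 'rV[R]_n :=
  grad (tlift f) (repr x).

Definition tdifferentiable (f : torus -> R) (x : torus) : Prop :=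
  differentiable (tlift f) (repr x).

Definition tC1 (f : torus -> R) : Prop :=
  (forall x, tdifferentiable f x) /\ continuous (tgrad f).

Definition torus_ae (P : torus -> Prop) : Prop :=
  lebesgue_outer [set y : 'rV[R]_n | ~ P (\pi_torus y)] = 0%E.

Variable m : nat.
Implicit Types f : torus -> 'rV[R]_m.

Definition tcomp f (i : 'I_m) : torus -> R := fun x => f x 0 i.

Definition tC1_vec f : Prop := forall i, tC1 (tcomp f i).

Definition tdifferentiable_vec f (x : torus) : Prop :=
  forall i, tdifferentiable (tcomp f i) x.

Definition tjacobian f (x : torus) : 'M[R]_(m, n) :=
  \matrix_(i, j) tgrad (tcomp f i) x 0 j.

End Torus.

Section Hamiltonians.
Variables (R : realType) (n m : nat).

Definition hamiltonian := 'I_m -> torus R n -> 'rV[R]_n -> 'rV[R]_m -> R.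

Variable H : hamiltonian.

Definition ham_continuous : Prop := forall i,
  continuous (fun y : torus R n * ('rV[R]_n * 'rV[R]_m) =>
                H i y.1 y.2.1 y.2.2).

Definition ham_coercive : Prop := forall (i : 'I_m) (r : R), 0 < r ->
  forall M : R, exists N : R, forall p : 'rV[R]_n, N <= enorm p ->
    (M%:E <= ereal_inf [set (H i w.1 p w.2)%:E
                       | w in [set w : torus R n * 'rV[R]_m |
                               (enorm w.2 < r)%R]])%E.

Definition ham_convex : Prop := forall (x : torus R n) (i : 'I_m),
  convex_function [set: convex_lmodType ('rV[R]_n * 'rV[R]_m)%type]
    (fun w => H i x w.1 w.2).

Definition ham_monotone : Prop :=
  forall (x : torus R n) (p : 'rV[R]_n) (u v : 'rV[R]_m) (k : 'I_m),
    (forall i, u 0 i - v 0 i <= u 0 k - v 0 k) -> 0 <= u 0 k - v 0 k ->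
    H k x p v <= H k x p u.

Definition subdifferential (F : 'rV[R]_n -> 'rV[R]_m -> R)
    (p : 'rV[R]_n) (u : 'rV[R]_m) : set ('rV[R]_n * 'rV[R]_m) :=
  [set w | forall q t,
     F p u + dotp w.1 (q - p) + dotp w.2 (t - u) <= F q t].

Definition lagrangian (i : 'I_m) (x : torus R n)
    (xi : 'rV[R]_n) (eta : 'rV[R]_m) : \bar R :=
  ereal_sup [set (dotp xi w.1 + dotp eta w.2 - H i x w.1 w.2)%:E
            | w in [set: 'rV[R]_n * 'rV[R]_m]].

Definition visc_subsolution (lam : R) (v : torus R n -> 'rV[R]_m) : Prop :=
  continuous v /\
  forall (i : 'I_m) (phi : torus R n -> R) (x : torus R n), tC1 phi ->
    (forall y, v y 0 i - phi y <= v x 0 i - phi x) ->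
    lam * v x 0 i + H i x (tgrad phi x) (v x) <= 0.

Definition visc_supersolution (lam : R) (v : torus R n -> 'rV[R]_m) : Prop :=
  continuous v /\
  forall (i : 'I_m) (phi : torus R n -> R) (x : torus R n), tC1 phi ->
    (forall y, v x 0 i - phi x <= v y 0 i - phi y) ->
    0 <= lam * v x 0 i + H i x (tgrad phi x) (v x).

Definition visc_solution (lam : R) (v : torus R n -> 'rV[R]_m) : Prop :=
  visc_subsolution lam v /\ visc_supersolution lam v.

End Hamiltonians.

Section Measures.
Variables (R : realType) (n m : nat).

(* A point is (x, (xi, eta)). *)
Local Notation phase := (torus R n * ('rV[R]_n * 'rV[R]_m))%type.

Definition borel_phase := g_sigma_algebraType (@open phase).

Definition measures := 'I_m -> {finite_measure set borel_phase -> \bar R}.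

Definition pairing (mu : measures) (phi : 'I_m -> phase -> \bar R) : \bar R :=
  (\sum_i \int[mu i]_y phi i y)%E.

Definition supp (nu : {finite_measure set borel_phase -> \bar R}) : set phase :=
  [set y | forall U : set phase, open U -> U y -> (0 < nu U)%E].

Definition in_P (lam : R) (mu : measures) : Prop :=
  (forall i, (\int[mu i]_y (enorm y.2.1 + enorm y.2.2)%:E < +oo)%E) /\
  pairing mu (fun _ y => (lam + \sum_j y.2.2 0 j)%:E) = 1%E.

Definition in_C (z : torus R n) (k : 'I_m) (lam : R) (mu : measures) : Prop :=
  in_P lam mu /\
  forall psi : torus R n -> 'rV[R]_m, tC1_vec psi ->
    pairing mu (fun i y =>
      (dotp y.2.1 (tgrad (tcomp psi i) y.1) + dotp y.2.2 (psi y.1)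
       + lam * psi y.1 0 i)%:E) = (psi z 0 k)%:E.

Definition Y (k : 'I_m) : set 'rV[R]_m :=
  [set eta | (forall i, i != k -> eta 0 i <= 0) /\ 0 <= \sum_i eta 0 i].

End Measures.

(* Main.v *)
From HB Require Import structures.
Require Import Defs.
From mathcomp Require Import all_boot all_order all_algebra.
From mathcomp Require Import all_classical all_reals all_analysis.
From mathcomp Require Import measurable_realfun ring lra.

Set Implicit Arguments.
Unset Strict Implicit.
Unset Printing Implicit Defensive.

Import Order.TTheory GRing.Theory Num.Theory.
Import numFieldNormedType.Exports.

Local Open Scope classical_set_scope.
Local Open Scope ring_scope.
Local Open Scope quotient_scope.

(** The measure mu is supported where Fenchel's inequality between L and H is an
    equality at a point (p, u) with |p| + |u| <= C.

    Suppose that psi is C^1, that |D psi_i| + |psi| <= C and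
    lam psi_i + H_i(x, D psi_i, psi) <= delta everywhere, and that
    |psi - v| <= delta ([smooth_subsolution]).  By the definition of L,

      L_i >= xi.D psi_i + eta.psi - H_i(x, D psi_i, psi)
          >= (xi.D psi_i + eta.psi + lam psi_i) - delta,

    and mu, being closed, integrates the last parenthesis to psi_k(z).  Since mu
    integrates L to v_k(z) <= psi_k(z) + delta, there is almost no room: the
    Fenchel gap L_i + H_i(x, p, u) - xi.p - eta.u, taken at
    (p, u) = (D psi_i, psi)(x), has an integral of order delta.  On the other
    hand, if w0 is a subgradient of H_i(x0, ., .) at no (p, u) of the compact
    set |p| + |u| <= C, then the gap at all these (p, u) is bounded below by
    some c > 0, uniformly on a neighbourhood of (x0, w0) ([uniform_gap]).
    Letting delta tend to 0, this neighbourhood is mu_i-null ([gap_set_null]), so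
    (x0, w0) is not in the support.  Hence a point (x0, w0) of the support has
    w0 in the subdifferential of H_i(x0, ., .) at some |p| + |u| <= C; this set
    lies in Q by hypothesis and in R^n x Y_i by monotonicity
    ([subdifferential_Y]).

    The function psi is the mean of v over small cubes.  Two facts about v are
    read off from viscosity test functions that are sums of periodic functions
    of one coordinate: v is Lipschitz because H is coercive ([sub_lipschitz]),
    and the inequality lam v_i + H_i(x, D v_i, v) <= 0 holds at every point of
    differentiability of v_i ([subsolution_at_differentiability]), that is,
    almost everywhere.  Jensen's inequality should then carry the convex
    constraints |p| + |u| <= C and lam u_i + H_i(x, p, u) <= delta from v to psi.
    It is obtained in [mollified_bound] without integrating over R^n.  Means
    over boxes are iterated one-dimensional means, and the jet of a mean over a
    box is the average of the jets of the means over its two halves, so that a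
    violated convex constraint is still violated on one half.  Bisecting, one
    reaches a point z at which the constraint on D v and v would fail in the
    limit if v_i is differentiable at z; a penalty that grows on a cover of the
    exceptional null set by open boxes of small total volume keeps z away from
    that set. *)

(** * Means over an interval *)

Section Mean.
Variable R : realType.
Implicit Types (g G : R -> R) (r h a b x : R).

(** The base point -1 leaves room to differentiate at 0. *)
Definition primitive g (x : R) : R :=
  \int[lebesgue_measure]_(t in [set` `[(-1), x]]) g t.

Definition mean r g : R := (primitive g r - primitive g 0) / r.

Lemma primitive_derive g x : continuous g -> -1 < x -> is_derive x 1 (primitive g) (g x).
Proof.
move=> cg x1.
have [| |dF <-] := @continuous_FTC1_closed R g (-1) x (x + 1) _ _ x1 (cg x).
- by rewrite ltrDl.
- apply: continuous_compact_integrable; first exact: segment_compact.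
  by apply: continuous_subspaceT.
by rewrite derive1E; exact: derivableP.
Qed.

Lemma mean_value G g a b : a <= b ->
  (forall x, a <= x <= b -> is_derive x 1 G (g x)) ->
  exists2 c, a <= c <= b & G b - G a = g c * (b - a).
Proof.
move=> ab dG.
have [| |c cab e] := @MVT_segment R G g a b ab.
- by move=> x; rewrite in_itv/= => /andP[ax xb]; apply: dG; rewrite !ltW.
- apply: derivable_within_continuous => x; rewrite in_itv/= => xab.
  by have [] := dG x xab.
by exists c => //; move: cab; rewrite in_itv.
Qed.

(** Any primitive computes the mean; shifts, halvings and linear combinations
    of integrands become the same operations on primitives. *)
Lemma mean_primitive r g G : 0 < r -> continuous g ->
  (forall x, 0 <= x -> is_derive x 1 G (g x)) -> mean r g = (G r - G 0) / r.
Proof.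
move=> r0 cg dG; rewrite /mean; congr (_ / _).
have [||c _] := @mean_value (primitive g - G) (fun=> 0) 0 r; first exact: ltW.
- move=> x /andP[x0 _]; have := primitive_derive cg (lt_le_trans (ltrN10 R) x0).
  move=> h1; have h2 := dG x x0.
  by rewrite -(subrr (g x)); exact: is_deriveB.
rewrite mul0r /= !fctE => h; lra.
Qed.

Lemma primitive_derive_ge0 g x : continuous g -> 0 <= x ->
  is_derive x 1 (primitive g) (g x).
Proof. by move=> cg x0; apply: primitive_derive => //; apply: lt_le_trans x0; lra. Qed.

Lemma meanD r g1 g2 : 0 < r -> continuous g1 -> continuous g2 ->
  mean r (fun t => g1 t + g2 t) = mean r g1 + mean r g2.
Proof.
move=> r0 c1 c2.
apply: (eq_trans (@mean_primitive r _ (primitive g1 + primitive g2) _ _ _)) => //.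
- by move=> x; apply: continuousD; [exact: c1|exact: c2].
- move=> x x0; have := primitive_derive_ge0 c1 x0; have := primitive_derive_ge0 c2 x0.
  by move=> ? ?; exact: is_deriveD.
by rewrite /mean !fctE; ring.
Qed.

Lemma meanZ r a g : 0 < r -> continuous g ->
  mean r (fun t => a * g t) = a * mean r g.
Proof.
move=> r0 c1.
apply: (eq_trans (@mean_primitive r _ (a *: primitive g) _ _ _)) => //.
- by move=> x; apply: continuousM; [exact: cst_continuous|exact: c1].
- move=> x x0; have := primitive_derive_ge0 c1 x0 => ?.
  exact: is_deriveZ.
by rewrite /mean !fctE /GRing.scale/=; ring.
Qed.

Lemma mean_cst r a : 0 < r -> mean r (fun=> a) = a.
Proof.
move=> r0.
apply: (eq_trans (@mean_primitive r _ (a *: id) _ _ _)) => //.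
- by move=> x; exact: cst_continuous.
- move=> x x0; rewrite -[X in is_derive _ _ _ X]mulr1.
  exact: is_deriveZ.
by rewrite !fctE /GRing.scale/=; field; rewrite gt_eqF.
Qed.

Lemma mean_le r g1 g2 : 0 < r -> continuous g1 -> continuous g2 ->
  (forall t, 0 <= t <= r -> g1 t <= g2 t) -> mean r g1 <= mean r g2.
Proof.
move=> r0 c1 c2 le12; rewrite /mean ler_pM2r ?invr_gt0//.
have [||c c0r] := @mean_value (primitive g2 - primitive g1) (fun t => g2 t - g1 t) 0 r.
- exact: ltW.
- move=> x /andP[x0 _]; have := primitive_derive_ge0 c1 x0.
  by have := primitive_derive_ge0 c2 x0 => ? ?; exact: is_deriveB.
rewrite !fctE => e; have := le12 c c0r; rewrite -(subr_ge0 (g1 c)) => h.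
have := mulr_ge0 h (ltW r0).
rewrite subr0 in e; lra.
Qed.

Lemma primitive_shift g h x : continuous g -> 0 <= h -> 0 <= x ->
  is_derive x 1 (fun t => primitive g (t + h)) (g (x + h)).
Proof.
move=> cg h0 x0.
have := primitive_derive_ge0 cg (addr_ge0 x0 h0) => d1.
rewrite -[X in is_derive _ _ _ X]mulr1.
have d2 : is_derive x 1 (fun t : R => t + h) 1.
  by rewrite -[X in is_derive _ _ _ X]addr0; exact: is_deriveD.
exact: (@is_derive1_comp _ (primitive g)).
Qed.

Lemma mean_shiftE r g h : 0 < r -> 0 <= h -> continuous g ->
  mean r (fun t => g (t + h)) = (primitive g (r + h) - primitive g h) / r.
Proof.
move=> r0 h0 cg.
apply: (eq_trans (@mean_primitive r _ (fun t => primitive g (t + h)) _ _ _)) => //.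
- move=> x; apply: (@continuous_comp _ _ _ (fun t : R => t + h) g); last exact: cg.
  by apply: continuousD; [exact: cvg_id|exact: cst_continuous].
- by move=> x x0; exact: primitive_shift.
by rewrite add0r.
Qed.

Lemma mean_half r g : 0 < r -> continuous g ->
  mean r g = 2^-1 * (mean (r / 2) g + mean (r / 2) (fun t => g (t + r / 2))).
Proof.
move=> r0 cg; have r20 : 0 < r / 2 by lra.
rewrite mean_shiftE// ?ltW// /mean.
have -> : r / 2 + r / 2 = r by lra.
by field; rewrite gt_eqF.
Qed.

(** The derivative of t |-> mean of g over [t, t + r] is (g(t + r) - g(t)) / r;
    the quadratic remainder is what survives taking further means in other
    directions. *)
Lemma mean_increment r g h K : 0 < r -> 0 <= h -> continuous g ->
  (forall s t, `|g s - g t| <= K * `|s - t|) ->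
  `|mean r (fun t => g (t + h)) - mean r g - h * ((g r - g 0) / r)|
    <= 2 * K / r * h ^+ 2.
Proof.
move=> r0 h0 cg lip.
rewrite mean_shiftE// /mean.
have K0 : 0 <= K.
  by have := le_trans (normr_ge0 _) (lip 1 0); rewrite subr0 normr1 mulr1.
have rh : r <= r + h by rewrite lerDl.
have [x /andP[rx _]|c1 /andP[c10 c1h] e1] := @mean_value (primitive g) g r (r + h) rh.
  by apply: primitive_derive_ge0 => //; apply: le_trans rx; exact: ltW.
have [x /andP[x0 _]|c2 /andP[c20 c2h] e2] := @mean_value (primitive g) g 0 h h0.
  exact: primitive_derive_ge0.
have -> : (primitive g (r + h) - primitive g h) / r - (primitive g r - primitive g 0) / r
    - h * ((g r - g 0) / r)
   = (((primitive g (r + h) - primitive g r) - (g r * h)) -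
       ((primitive g h - primitive g 0) - g 0 * h)) / r by ring.
rewrite e1 e2 normrM normfV (gtr0_norm r0) mulrAC ler_pM2r ?invr_gt0//.
apply: le_trans (ler_normB _ _) _.
rewrite addrAC subrr add0r subr0 -!mulrBl !normrM (ger0_norm h0).
have l1 : `|g c1 - g r| <= K * h.
  apply: le_trans (lip _ _) _; rewrite ler_wpM2l// ger0_norm; lra.
have l2 : `|g c2 - g 0| <= K * h.
  apply: le_trans (lip _ _) _; rewrite ler_wpM2l// ger0_norm; lra.
have := ler_wpM2r h0 l1; have := ler_wpM2r h0 l2; rewrite expr2; lra.
Qed.

End Mean.

(** * Iterated means and difference quotients over boxes *)

Lemma continuous_at_normP (R : realType) (V W : normedModType R) (f : V -> W)
    (y : V) :
  {for y, continuous f} <->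
  forall eps : R, 0 < eps -> exists2 d : R, 0 < d &
    forall z, `|y - z| < d -> `|f y - f z| < eps.
Proof.
split=> [/cvgrPdist_lt cf eps /cf /nbhs_normP[d /= d0 h]|h].
  by exists d => // z yz; exact: h.
apply/cvgrPdist_lt => eps /h[d d0 {}h].
by apply/nbhs_normP; exists d => //= z; exact: h.
Qed.

Section Boxmean.
Variables (R : realType) (n : nat).
Local Notation V := 'rV[R]_n.
Local Notation e j := (delta_mx 0 j : V).
Implicit Types (f g : V -> R) (y z a s : V) (i j : 'I_n) (K h c : R).

Lemma rV_norm_le y c : 0 <= c -> (forall j, `|y 0 j| <= c) -> `|y| <= c.
Proof.
move=> c0 h; rewrite [leLHS]/Num.norm /= mx_normrE; apply/bigmax_leP; split => //.
by case=> i j _ /=; rewrite ord1.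
Qed.

Lemma coord_norm_le y j : `|y 0 j| <= `|y|.
Proof.
rewrite [leRHS]/Num.norm /= mx_normrE.
by apply/bigmax_geP; right => /=; exists (0, j).
Qed.

Lemma delta_coordE j i : e j 0 i = (i == j)%:R.
Proof. by rewrite mxE eqxx. Qed.

Lemma norm_delta j : `|e j| <= 1.
Proof.
apply: rV_norm_le => // i; rewrite delta_coordE.
by case: eqP => _; rewrite ?normr1 ?normr0.
Qed.

Definition lip K f := 0 <= K /\ forall y z, `|f y - f z| <= K * `|y - z|.

Lemma lip_continuous K f : lip K f -> continuous f.
Proof.
move=> [K0 lf] y; apply/continuous_at_normP => eps eps0.
have K1 : 0 < K + 1 by rewrite ltr_wpDl.
exists ((K + 1)^-1 * eps); first by rewrite mulr_gt0 ?invr_gt0.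
move=> z yz; apply: le_lt_trans (lf _ _) _.
apply: (@le_lt_trans _ _ ((K + 1) * `|y - z|)).
  by rewrite ler_wpM2r// lerDl.
by rewrite -ltr_pdivlMl.
Qed.

Lemma line_lip K f y j : lip K f ->
  forall u t, `|f (y + u *: e j) - f (y + t *: e j)| <= K * `|u - t|.
Proof.
move=> [K0 lf] u t; apply: le_trans (lf _ _) _.
rewrite opprD addrACA subrr add0r -scalerBl normrZ.
by rewrite ler_wpM2l// ler_piMr// norm_delta.
Qed.

Lemma line_continuous f y j : continuous f ->
  continuous (fun t : R => f (y + t *: e j)).
Proof.
move=> cf t; apply: (@continuous_comp _ _ _ (fun t : R => y + t *: e j) f).
  apply: continuousD; first exact: cst_continuous.
  exact: scalel_continuous.
exact: cf.
Qed.

Definition axis_mean j (r : R) f : V -> R :=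
  fun y => mean r (fun t => f (y + t *: e j)).
Definition axis_diff j (r : R) f : V -> R := fun y => (f (y + r *: e j) - f y) / r.

(** Averaging in the direction j and then differentiating in the same direction
    is a difference quotient.  With [b = Some j] the operator attached to the
    axis j is that quotient, so that one family of operators describes both the
    mean over a box ([b = None]) and its partial derivatives. *)
Definition axis_op (b : option 'I_n) j (r : R) f : V -> R :=
  if b == Some j then axis_diff j r f else axis_mean j r f.

Definition box_op b (l : seq 'I_n) s f : V -> R :=
  foldr (fun j g => axis_op b j (s 0 j) g) f l.

Definition lipschitz f := exists K, lip K f.

Lemma lipschitz_continuous f : lipschitz f -> continuous f.
Proof. by case=> K; exact: lip_continuous. Qed.

Lemma lipschitz_line f y j : lipschitz f ->
  continuous (fun t : R => f (y + t *: e j)).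
Proof. by move/lipschitz_continuous; exact: line_continuous. Qed.

Lemma lip_shift K f a : lip K f -> lip K (fun y => f (y + a)).
Proof.
move=> [K0 lf]; split=> // y z; have := lf (y + a) (z + a).
by rewrite opprD addrACA subrr addr0.
Qed.

Lemma lip_comb K L f g : lip K f -> lip L g ->
  forall c, lip (`|c| * K + L) (fun y => c * f y + g y).
Proof.
move=> [K0 lf] [L0 lg] c; split; first by rewrite addr_ge0// mulr_ge0.
move=> y z; rewrite opprD addrACA -mulrBr (le_trans (ler_normD _ _))//.
by rewrite mulrDl lerD// normrM -mulrA ler_wpM2l.
Qed.

Lemma lipschitz_comb f g c : lipschitz f -> lipschitz g ->
  lipschitz (fun y => c * f y + g y).
Proof. by move=> [K lf] [L lg]; eexists; exact: (lip_comb lf lg c). Qed.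

Lemma lipschitz_shift f a : lipschitz f -> lipschitz (fun y => f (y + a)).
Proof. by move=> [K lf]; exists K; exact: lip_shift. Qed.

Lemma lip_cst c : lip 0 (fun=> c).
Proof. by split=> // y z; rewrite subrr normr0 mul0r. Qed.

Lemma lipschitz_cst c : lipschitz (fun=> c).
Proof. by exists 0; exact: lip_cst. Qed.

Lemma axis_mean_comb j r f g c y : 0 < r -> lipschitz f -> lipschitz g ->
  axis_mean j r (fun y => c * f y + g y) y
  = c * axis_mean j r f y + axis_mean j r g y.
Proof.
move=> r0 lf lg; rewrite /axis_mean.
have cf := lipschitz_line (y:=y) (j:=j) lf; have cg := lipschitz_line (y:=y) (j:=j) lg.
rewrite -meanZ// -meanD// => t.
by apply: continuousM; [exact: cst_continuous|exact: cf].
Qed.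

Lemma axis_mean_le j r f g y : 0 < r -> lipschitz f -> lipschitz g ->
  (forall t, 0 <= t <= r -> f (y + t *: e j) <= g (y + t *: e j)) ->
  axis_mean j r f y <= axis_mean j r g y.
Proof. by move=> r0 lf lg; apply: mean_le => //; exact: lipschitz_line. Qed.

Lemma axis_mean_cst j r c y : 0 < r -> axis_mean j r (fun=> c) y = c.
Proof. exact: mean_cst. Qed.

Lemma axis_mean_norm j r f y c : 0 < r -> lipschitz f ->
  (forall t, 0 <= t <= r -> `|f (y + t *: e j)| <= c) ->
  `|axis_mean j r f y| <= c.
Proof.
move=> r0 lf h; rewrite ler_norml; apply/andP; split.
- rewrite -[leLHS](axis_mean_cst j _ y r0); apply: axis_mean_le => //.
    exact: lipschitz_cst.
  by move=> t /h; rewrite ler_norml => /andP[].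
- rewrite -[leRHS](axis_mean_cst j _ y r0); apply: axis_mean_le => //.
    exact: lipschitz_cst.
  by move=> t /h; rewrite ler_norml => /andP[].
Qed.

Lemma axis_op_comb b j r f g c y : 0 < r -> lipschitz f -> lipschitz g ->
  axis_op b j r (fun y => c * f y + g y) y
  = c * axis_op b j r f y + axis_op b j r g y.
Proof.
rewrite /axis_op; case: ifP => _; last exact: axis_mean_comb.
by move=> *; rewrite /axis_diff; ring.
Qed.

Lemma axis_op_shift b j r f a :
  axis_op b j r (fun y => f (y + a)) = fun y => axis_op b j r f (y + a).
Proof.
apply/funext => y; rewrite /axis_op; case: ifP => _.
  by rewrite /axis_diff addrAC.
by rewrite /axis_mean; congr mean; apply/funext => t; rewrite addrAC.
Qed.

Lemma axis_mean_lip j r K f : 0 < r -> lip K f -> lip K (axis_mean j r f).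
Proof.
move=> r0 lf; split; first by case: lf.
move=> y z; have -> : axis_mean j r f y - axis_mean j r f z
  = axis_mean j r (fun u => -1 * f u + f (u + (y - z))) z.
  rewrite axis_mean_comb//; first last.
  - by exists K; exact: lip_shift.
  - by exists K.
  have := axis_op_shift None j r f (y - z).
  rewrite /axis_op/= => ->.
  by rewrite addrC mulN1r [z + _]addrC subrK.
apply: axis_mean_norm => //.
  by apply: lipschitz_comb; [exists K | exists K; exact: lip_shift].
move=> t _; rewrite mulN1r addrC.
case: lf => _ /(_ _ _)/le_trans; apply.
by rewrite [_ + _ + (y - z)]addrC addrK.
Qed.

Lemma axis_diff_norm j r K f y : 0 < r -> lip K f -> `|axis_diff j r f y| <= K.
Proof.
move=> r0 lf; rewrite /axis_diff normrM normfV (gtr0_norm r0) ler_pdivrMr//.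
by have := line_lip y j lf r 0; rewrite scale0r addr0 subr0 (gtr0_norm r0).
Qed.

Lemma axis_op_lipschitz b j r f : 0 < r -> lipschitz f ->
  lipschitz (axis_op b j r f).
Proof.
move=> r0 [K lf]; rewrite /axis_op; case: ifP => _; last first.
  by exists K; exact: axis_mean_lip.
have -> : axis_diff j r f = fun y => r^-1 * f (y + r *: e j) + (- r^-1 * f y + 0).
  by apply/funext => y; rewrite /axis_diff; ring.
apply: lipschitz_comb; first by exists K; exact: lip_shift.
by apply: lipschitz_comb; [exists K|exact: lipschitz_cst].
Qed.

(** The integral is additive, and the difference quotients telescope. *)
Lemma axis_op_half b j r f y : 0 < r -> lipschitz f ->
  axis_op b j r f y =
  2^-1 * (axis_op b j (r / 2) f y + axis_op b j (r / 2) f (y + (r / 2) *: e j)).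
Proof.
move=> r0 lf; rewrite /axis_op; case: ifP => _.
  have e2 : y + (r / 2) *: e j + (r / 2) *: e j = y + r *: e j.
    by rewrite -addrA -scalerDl; congr (_ + _ *: _); lra.
  rewrite /axis_diff e2.
  by field; rewrite gt_eqF.
rewrite /axis_mean mean_half//; last exact: lipschitz_line.
congr (_ * (_ + mean _ _)); apply/funext => t.
by rewrite scalerDl addrCA addrA [y + _ + _]addrC addrA.
Qed.

End Boxmean.

Section Boxop.
Variables (R : realType) (n : nat).
Local Notation V := 'rV[R]_n.
Local Notation e j := (delta_mx 0 j : V).
Implicit Types (f g : V -> R) (y z a s : V) (i j : 'I_n) (K h c : R).
Implicit Types (b : option 'I_n) (l : seq 'I_n).

Definition pos_sides s := forall j, 0 < s 0 j.

Definition halve s j : V := \row_i (if i == j then s 0 i / 2 else s 0 i).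

Lemma halve_pos s j : pos_sides s -> pos_sides (halve s j).
Proof. by move=> s0 i; rewrite mxE; case: ifP => // _; rewrite divr_gt0. Qed.

Lemma box_op_lipschitz b l s f : pos_sides s -> lipschitz f ->
  lipschitz (box_op b l s f).
Proof. by move=> s0 lf; elim: l => //= j l; exact: axis_op_lipschitz. Qed.

Lemma box_op_comb b l s f g c y : pos_sides s -> lipschitz f -> lipschitz g ->
  box_op b l s (fun y => c * f y + g y) y
  = c * box_op b l s f y + box_op b l s g y.
Proof.
move=> s0 lf lg; elim: l y => //= j l IH y.
by rewrite (funext IH) axis_op_comb//; exact: box_op_lipschitz.
Qed.

Lemma box_op_shift b l s f a :
  box_op b l s (fun y => f (y + a)) = fun y => box_op b l s f (y + a).
Proof. by elim: l => //= j l ->; rewrite axis_op_shift. Qed.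

Lemma box_mean_cst l s c y : pos_sides s -> box_op None l s (fun=> c) y = c.
Proof.
move=> s0; elim: l y => //= j l IH y; rewrite (funext IH).
exact: axis_mean_cst.
Qed.

Lemma box_op_ext b l s s' f : {in l, forall i, s 0 i = s' 0 i} ->
  box_op b l s f = box_op b l s' f.
Proof.
elim: l => //= j l IH h; rewrite IH; last by move=> i il; apply: h; rewrite inE il orbT.
by rewrite h// mem_head.
Qed.

(** The operators on the other axes are linear and commute with translations,
    so that the halving identity of one axis passes through them. *)
Lemma box_op_half b l s f y j : pos_sides s -> lipschitz f -> uniq l -> j \in l ->
  box_op b l s f y =
  2^-1 * (box_op b l (halve s j) f y
          + box_op b l (halve s j) f (y + (s 0 j / 2) *: e j)).
Proof.
move=> s0 lf; have s'0 := halve_pos j s0.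
elim: l y => //= i l IH y /andP[il ul]; rewrite inE.
have [ij|ji] := eqVneq j i; rewrite ?orTb ?orFb; first subst i.
  move=> _; rewrite (@box_op_ext b l (halve s j) s); last first.
    by move=> i il'; rewrite mxE; case: eqP => // ij; rewrite -ij il' in il.
  rewrite axis_op_half//; last exact: box_op_lipschitz.
  by rewrite mxE eqxx.
move=> jl; have lT := box_op_lipschitz b l s'0 lf.
have lT' := lipschitz_shift ((s 0 j / 2) *: e j) lT.
have -> : box_op b l s f =
    fun y => 2^-1 * box_op b l (halve s j) f y
       + (2^-1 * box_op b l (halve s j) f (y + (s 0 j / 2) *: e j) + 0).
  by apply/funext => y'; rewrite (IH y' ul jl) addr0 mulrDr.
rewrite [halve s j 0 i]mxE eq_sym (negbTE ji).
rewrite axis_op_comb//; last by apply: lipschitz_comb => //; exact: lipschitz_cst.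
rewrite axis_op_comb//; last exact: lipschitz_cst.
rewrite axis_op_shift mulrDr -[RHS]addr0 -!addrA; congr (_ + (_ + _)).
rewrite /axis_op; case: ifP => _; last by rewrite axis_mean_cst.
by rewrite /axis_diff subrr mul0r.
Qed.

(** The norm of [box_op b l s] for the supremum over the box: a difference
    quotient over a side of length r costs a factor 2 / r. *)
Definition op_weight b l s : R :=
  \prod_(i <- l) (if b == Some i then 2 / s 0 i else 1).

Lemma op_weight_None l s : op_weight None l s = 1.
Proof. by rewrite /op_weight big1. Qed.

Lemma op_weight_Some j s : op_weight (Some j) (enum 'I_n) s = 2 / s 0 j.
Proof.
rewrite /op_weight big_enum (bigD1 j)//= eqxx big1 ?mulr1// => i ij.
by case: eqP => // -[ji]; rewrite ji eqxx in ij.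
Qed.

Lemma box_op_norm b l s f y c : pos_sides s -> lipschitz f -> uniq l ->
  (forall a, (forall i, 0 <= a 0 i <= if i \in l then s 0 i else 0) ->
     `|f (y + a)| <= c) ->
  `|box_op b l s f y| <= op_weight b l s * c.
Proof.
move=> s0 lf; elim: l y => [y _ h|j l IH y /= /andP[jl ul] h].
  rewrite /= /op_weight big_nil mul1r -[y]addr0; apply: h => i.
  by rewrite mxE lexx.
have {}IH t : 0 <= t <= s 0 j ->
    `|box_op b l s f (y + t *: e j)| <= op_weight b l s * c.
  move=> t0; apply: IH => // a ha; rewrite -addrA; apply: h => i.
  have := ha i; rewrite !mxE eqxx/= inE.
  have [->|ij] := eqVneq i j; last by rewrite mulr0 add0r.
  by rewrite (negbTE jl)/= => ai; lra.
have lT := box_op_lipschitz b l s0 lf.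
rewrite /axis_op /op_weight big_cons -/(op_weight b l s); case: ifP => _; last first.
  by rewrite mul1r; apply: axis_mean_norm.
rewrite /axis_diff normrM normfV (gtr0_norm (s0 j)) ler_pdivrMr//.
apply: le_trans (ler_normB _ _) _.
have := IH (s 0 j); have := IH 0; rewrite scale0r addr0 !lexx (ltW (s0 j)).
move=> /(_ erefl) h1 /(_ erefl) h2.
have -> : 2 / s 0 j * op_weight b l s * c * s 0 j = 2 * (op_weight b l s * c).
  by field; rewrite gt_eqF.
lra.
Qed.

Lemma box_mean_lip l s K f : pos_sides s -> lip K f -> lip K (box_op None l s f).
Proof. by move=> s0 lf; elim: l => //= j l; exact: axis_mean_lip. Qed.

Lemma box_op_notin j l s f : j \notin l -> box_op (Some j) l s f = box_op None l s f.
Proof.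
elim: l => //= i l IH; rewrite inE negb_or => /andP[ij jl].
rewrite IH// /axis_op /=; case: ifP => // /eqP[ji].
by rewrite ji eqxx in ij.
Qed.

(** Unlike [box_op_norm], this bound does not degenerate when the box shrinks:
    the Lipschitz constant of f is what bounds the jets of all means. *)
Lemma box_diff_norm j l s K f y : pos_sides s -> lip K f -> uniq l -> j \in l ->
  `|box_op (Some j) l s f y| <= K.
Proof.
move=> s0 lf; elim: l y => //= i l IH y /andP[il ul]; rewrite inE.
have [ij|ji] := eqVneq j i; rewrite ?orTb ?orFb; first subst i.
  move=> _; rewrite /axis_op eqxx box_op_notin//; apply: axis_diff_norm => //.
  exact: box_mean_lip.
move=> jl; rewrite /axis_op; case: eqP => [[ij]|_].
  by rewrite ij eqxx in ji.
apply: axis_mean_norm => //; first by apply: box_op_lipschitz => //; exists K.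
by move=> t _; exact: IH.
Qed.

(** The quadratic remainder of [mean_increment] in the axis j is preserved by the
    means in the other axes, whatever their order. *)
Lemma box_mean_deriv j l s K f y h : pos_sides s -> lip K f -> uniq l -> j \in l ->
  0 <= h ->
  `|box_op None l s f (y + h *: e j) - box_op None l s f y
    - h * box_op (Some j) l s f y| <= 2 * K / s 0 j * h ^+ 2.
Proof.
move=> s0 lf; have lf' : lipschitz f by exists K.
elim: l y => //= i l IH y /andP[il ul]; rewrite inE => + h0.
have lT b := box_op_lipschitz b l s0 lf'.
have [ij|ji] := eqVneq j i; rewrite ?orTb ?orFb; first subst i.
  move=> _; rewrite /axis_op eqxx box_op_notin//=.
  set g := box_op None l s f.
  have lg : lip K g by exact: box_mean_lip.
  have := mean_increment (s0 j) h0 (lipschitz_line (y:=y) (j:=j) (lT None))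
    (line_lip y j lg).
  rewrite scale0r addr0; apply: le_trans.
  rewrite le_eqVlt; apply/orP; left; apply/eqP; congr (`|mean _ _ - _ - _|).
  by apply/funext => t; rewrite [t + h]addrC scalerDl addrA.
move=> jl; rewrite /axis_op/=; case: eqP => [[ij]|_].
  by rewrite ij eqxx in ji.
set g := box_op None l s f; set d := box_op (Some j) l s f.
have lg : lipschitz g by exact: lT.
have ld : lipschitz d by exact: lT.
have -> : axis_mean i (s 0 i) g (y + h *: e j) - axis_mean i (s 0 i) g y
    - h * axis_mean i (s 0 i) d y
  = axis_mean i (s 0 i)
      (fun u => (-1) * g u + ((- h) * d u + g (u + h *: e j))) y.
  have lgs := lipschitz_shift (h *: e j) lg.
  rewrite axis_mean_comb//; last exact: lipschitz_comb.
  rewrite axis_mean_comb//.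
  have := axis_op_shift None i (s 0 i) g (h *: e j).
  by rewrite /axis_op/= => ->; ring.
apply: axis_mean_norm => //.
  by do 2 apply: lipschitz_comb => //; exact: lipschitz_shift.
move=> t _; have := IH (y + t *: e i) ul jl h0.
by rewrite -/g -/d; congr (`|_| <= _); ring.
Qed.

(** An affine function is translated by a constant, so its mean has increments
    h p_j along the axis j; [box_mean_deriv] then identifies the derivative. *)
Lemma box_diff_affine j l s (p : V) c y : pos_sides s -> uniq l -> j \in l ->
  box_op (Some j) l s (fun y => c + dotp p y) y = p 0 j.
Proof.
move=> s0 ul jl; set L := fun _ => _.
have dotD u v : dotp p (u + v) = dotp p u + dotp p v.
  by rewrite /dotp -big_split/=; apply: eq_bigr => i _; rewrite !mxE mulrDr.
have dote h : dotp p (h *: e j) = h * p 0 j.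
  rewrite /dotp (bigD1 j)//= big1 ?addr0 => [|i ij]; rewrite !mxE eqxx/=.
    by rewrite eqxx mulr1 mulrC.
  by rewrite (negbTE ij) !mulr0.
have [K lL] : lipschitz L.
  exists (\sum_i `|p 0 i|); split; first by apply: sumr_ge0.
  move=> u v; rewrite /L opprD addrACA subrr add0r.
  rewrite /dotp -sumrB mulr_suml; apply: le_trans (ler_norm_sum _ _ _) _.
  apply: ler_sum => i _; rewrite -mulrBr normrM ler_wpM2l//.
  by have := coord_norm_le (u - v) i; rewrite !mxE.
have lL' : lipschitz L by exists K.
have D h : box_op None l s L (y + h *: e j) - box_op None l s L y = h * p 0 j.
  have <- : box_op None l s (fun u => L (u + h *: e j)) y
     = box_op None l s L (y + h *: e j) by rewrite box_op_shift.
  have -> : (fun u => L (u + h *: e j)) = fun u => 1 * L u + h * p 0 j.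
    by apply/funext => u; rewrite /L dotD dote; ring.
  rewrite box_op_comb// ?box_mean_cst//; last exact: lipschitz_cst.
  by ring.
have M h : 0 < h -> `|p 0 j - box_op (Some j) l s L y| <= 2 * K / s 0 j * h.
  move=> h0; have := box_mean_deriv y s0 lL ul jl (ltW h0).
  rewrite D -mulrBr normrM (gtr0_norm h0) expr2 mulrCA.
  by rewrite ler_pM2l.
apply/eqP; rewrite eq_sym -subr_eq0 -normr_le0; apply/ler_addgt0Pr => eps eps0.
have C0 : 0 <= 2 * K / s 0 j.
  by apply: divr_ge0; [apply: mulr_ge0 => //; case: lL|exact: ltW].
have C1 : 0 < 2 * K / s 0 j + 1 by rewrite ltr_wpDl.
rewrite add0r; apply: le_trans (M (eps / (2 * K / s 0 j + 1)) _) _.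
  by rewrite divr_gt0.
by rewrite mulrCA ler_piMr ?ltW// ltr_pdivrMr// mul1r ltrDl.
Qed.

End Boxop.

(** * Differentiability by first-order expansions *)

Lemma diff_approx (R : realType) (V : normedModType R) (f : V -> R)
    (L : {linear V -> R}) (x : V) : continuous L ->
  (forall eps : R, 0 < eps -> exists2 d : R, 0 < d & forall h, `|h| < d ->
     `|f (h + x) - f x - L h| <= eps * `|h|) ->
  differentiable f x /\ 'd f x = L :> (V -> R).
Proof.
move=> cL h.
have E : f \o shift x = cst (f x) + L +o_ 0 id.
  apply/eqaddoP => eps eps0; have [d d0 hd] := h _ eps0.
  apply/nbhs_normP; exists d => // y /= yd0.
  have yd : `|y| < d by rewrite -normrN -[- y]add0r.
  by have := hd y yd; rewrite !fctE /= opprD addrA.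
have D := diff_unique cL E; split => //.
by apply/diff_locallyP; rewrite D.
Qed.

Lemma approx_diff (R : realType) (V : normedModType R) (f : V -> R) (x : V) :
  differentiable f x ->
  forall eps : R, 0 < eps -> exists2 d : R, 0 < d & forall h, `|h| < d ->
     `|f (h + x) - f x - 'd f x h| <= eps * `|h|.
Proof.
move=> /diff_locallyP[_ /eqaddoP E] eps eps0.
have /nbhs_normP[d /= d0 h] := E eps eps0; exists d => // y yd.
have h0 : `|0 - y| < d by rewrite sub0r normrN.
by have /= := h y h0; rewrite !fctE /= opprD addrA.
Qed.

Section Gradient.
Variables (R : realType) (n : nat).
Local Notation V := 'rV[R]_n.
Local Notation e j := (delta_mx 0 j : V).
Implicit Types (f g : V -> R) (y z a s p : V) (i j : 'I_n) (C K h c : R).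

Lemma dotpDr p y z : dotp p (y + z) = dotp p y + dotp p z.
Proof. by rewrite /dotp -big_split/=; apply: eq_bigr => i _; rewrite !mxE mulrDr. Qed.

Lemma dotpZr p c y : dotp p (c *: y) = c * dotp p y.
Proof. by rewrite /dotp mulr_sumr; apply: eq_bigr => i _; rewrite !mxE mulrCA. Qed.

Lemma dotpBr p y z : dotp p (y - z) = dotp p y - dotp p z.
Proof. by rewrite dotpDr -scaleN1r dotpZr mulN1r. Qed.

Lemma dotp_delta p j : dotp p (e j) = p 0 j.
Proof.
rewrite /dotp (bigD1 j)//= big1 ?addr0 => [|i ij]; rewrite delta_coordE.
  by rewrite eqxx mulr1.
by rewrite (negbTE ij) mulr0.
Qed.

Lemma dotp_norm_le p y : `|dotp p y| <= (\sum_i `|p 0 i|) * `|y|.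
Proof.
rewrite /dotp mulr_suml; apply: le_trans (ler_norm_sum _ _ _) _.
by apply: ler_sum => i _; rewrite normrM ler_wpM2l// coord_norm_le.
Qed.

Lemma dotp_lip p c : lip (\sum_i `|p 0 i|) (fun y => c + dotp p y).
Proof.
split; first by apply: sumr_ge0.
by move=> u v; rewrite opprD addrACA subrr add0r -dotpBr dotp_norm_le.
Qed.

Lemma dotp_continuous p : continuous (dotp p).
Proof.
have -> : dotp p = fun y => 0 + dotp p y by apply/funext => y; rewrite add0r.
by apply: lip_continuous; exact: dotp_lip.
Qed.

Lemma diff_gradP f y p :
  (forall eps : R, 0 < eps -> exists2 d : R, 0 < d & forall h : V, `|h| < d ->
     `|f (h + y) - f y - dotp p h| <= eps * `|h|) ->
  differentiable f y /\ grad f y = p.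
Proof.
move=> H.
have lin : linear (dotp p) by move=> k u v; rewrite dotpDr dotpZr.
pose LM := GRing.isLinear.Build _ _ _ _ _ lin.
pose L : {linear V -> R} := HB.pack (dotp p) LM.
have [D E] := @diff_approx _ _ f L y (@dotp_continuous p) H.
split=> //; apply/rowP => j; rewrite /grad mxE deriveE// E /=.
exact: dotp_delta.
Qed.

Lemma row_basisE y : y = \sum_j y 0 j *: e j.
Proof. exact: row_sum_delta. Qed.

Lemma diff_dotp f y (h : V) : differentiable f y -> 'd f y h = dotp (grad f y) h.
Proof.
move=> df; rewrite [in LHS](row_basisE h) linear_sum /dotp; apply: eq_bigr => j _.
by rewrite linearZ /grad mxE deriveE// /GRing.scale/= mulrC.
Qed.

Lemma grad_approx f y : differentiable f y ->
  forall eps : R, 0 < eps -> exists2 d : R, 0 < d & forall h : V, `|h| < d ->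
     `|f (h + y) - f y - dotp (grad f y) h| <= eps * `|h|.
Proof.
move=> df eps eps0; have [d d0 H] := approx_diff df eps0; exists d => // h hd.
by rewrite -diff_dotp//; exact: H.
Qed.

(** A function whose partial derivatives exist with a uniform quadratic remainder
    and are Lipschitz is differentiable: move along one axis at a time. *)
Lemma diff_partial f (D : 'I_n -> V -> R) C K :
  0 <= C -> (forall j, lip K (D j)) ->
  (forall y j h, 0 <= h ->
     `|f (y + h *: e j) - f y - h * D j y| <= C * h ^+ 2) ->
  forall y, differentiable f y /\ grad f y = \row_j D j y.
Proof.
move=> C0 lD H y.
have K0 j : 0 <= K by have [] := lD j.
(* for h < 0, exchange the end points; the slope then moves by at most K |h| *)
have H2 (u : V) j (h : R) : `|f (u + h *: e j) - f u - h * D j u| <= (C + K) * h ^+ 2.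
  have [h0|h0] := leP 0 h.
    apply: le_trans (H _ _ _ h0) _; rewrite ler_wpM2r ?sqr_ge0// lerDl.
    exact: (K0 j).
  have := H (u + h *: e j) j (- h); rewrite oppr_ge0 (ltW h0) => /(_ erefl).
  rewrite scaleNr addrK sqrrN => h1.
  have [_ lDj] := lD j.
  have h2 : `|h * D j (u + h *: e j) - h * D j u| <= K * h ^+ 2.
    rewrite -mulrBr normrM; apply: le_trans (ler_wpM2l (normr_ge0 _) (lDj _ _)) _.
    rewrite addrAC subrr add0r mulrCA ler_wpM2l ?(K0 j)//.
    rewrite normrZ mulrA -normrM -expr2 ger0_norm ?sqr_ge0//.
    by rewrite ler_piMr ?sqr_ge0// norm_delta.
  rewrite mulrDl; move: h1 h2; rewrite !ler_norml => /andP[? ?] /andP[? ?].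
  by clear K0; apply/andP; split; lra.
pose P (l : seq 'I_n) (h : V) := \sum_(j <- l) h 0 j *: e j.
have PN l (h : V) : `|P l h| <= (size l)%:R * `|h|.
  elim: l => [|j l IH]; rewrite /P ?big_nil ?normr0 ?mul0r//.
  rewrite big_cons /= -natr1 mulrDl mul1r addrC.
  apply: le_trans (ler_normD _ _) _; apply: lerD => //.
  rewrite normrZ; apply: le_trans (coord_norm_le h j).
  by rewrite ler_piMr// norm_delta.
have Q l : exists2 M : R, 0 <= M & forall h : V,
   `|f (y + P l h) - f y - \sum_(j <- l) h 0 j * D j y| <= M * `|h| ^+ 2.
  elim: l => [|j l [M M0 IH]].
    by exists 0 => // h'; rewrite /P !big_nil addr0 subrr subr0 normr0 mul0r.
  exists (M + (C + K) + K * (size l)%:R).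
    by rewrite !addr_ge0// ?mulr_ge0// (K0 j).
  move=> h'; have h1 := IH h'; have h2 := H2 (y + P l h') j (h' 0 j).
  have Pc : P (j :: l) h' = P l h' + h' 0 j *: e j by rewrite /P big_cons addrC.
  rewrite Pc big_cons.
  have [_ lDj] := lD j.
  have hj := coord_norm_le h' j.
  have h3 : `|h' 0 j * D j (y + P l h') - h' 0 j * D j y| <=
      K * (size l)%:R * `|h'| ^+ 2.
    rewrite -mulrBr normrM; apply: le_trans (ler_wpM2l (normr_ge0 _) (lDj _ _)) _.
    rewrite addrAC subrr add0r mulrCA -mulrA ler_wpM2l ?(K0 j)//.
    by rewrite expr2 mulrCA ler_pM.
  have h4 : (C + K) * (h' 0 j) ^+ 2 <= (C + K) * `|h'| ^+ 2.
    apply: ler_wpM2l; first by rewrite addr_ge0 ?(K0 j).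
    by rewrite -[X in X <= _]real_normK ?num_real// lerXn2r ?nnegrE.
  rewrite [X in f X](_ : _ = y + P l h' + h' 0 j *: e j); last exact: addrA.
  rewrite !mulrDl.
  move: h1 h2 h3 h4; rewrite !ler_norml => /andP[? ?] /andP[? ?] /andP[? ?] ?.
  by clear K0; apply/andP; split; lra.
apply: diff_gradP => eps eps0.
have [M M0 HM] := Q (enum 'I_n).
have M1 : 0 < M + 1 by rewrite ltr_wpDl.
exists (eps / (M + 1)); first by rewrite divr_gt0.
move=> h hd; have := HM h; rewrite /P !big_enum/= -row_basisE [y + h]addrC.
have -> : \sum_j h 0 j * D j y = dotp (\row_j D j y) h.
  by rewrite /dotp; apply: eq_bigr => j _; rewrite mxE mulrC.
move=> /le_trans; apply; rewrite expr2 mulrA ler_wpM2r//.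
move: hd; rewrite ltr_pdivlMr// mulrDr mulr1 mulrC => /ltW; apply: le_trans.
by rewrite lerDl.
Qed.

End Gradient.

(** * The C^1 mean of a Lipschitz function over a box *)

Lemma rV_continuous (R : realType) (T : topologicalType) m (F : T -> 'rV[R]_m) :
  (forall j : 'I_m, continuous (fun x => F x 0 j)) -> continuous F.
Proof.
move=> cF x; apply/cvgrPdist_lt => eps eps0.
have : \forall t \near x, forall j : 'I_m, `|F x 0 j - F t 0 j| < eps / 2.
  apply: filter_forall => j; have /cvgrPdist_lt := cF j x; apply.
  by rewrite divr_gt0.
apply: filterS => t ht; apply: (@le_lt_trans _ _ (eps / 2)); last by lra.
apply: rV_norm_le => [|j]; first by lra.
by rewrite !mxE ltW.
Qed.

Section BoxMean.
Variables (R : realType) (n : nat).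
Local Notation V := 'rV[R]_n.
Local Notation e j := (delta_mx 0 j : V).
Implicit Types (f g : V -> R) (y z a s p : V) (i j : 'I_n) (C K h c r eps : R).

Definition bmean s f : V -> R := box_op None (enum 'I_n) s f.
Definition bgrad s f y : V := \row_j box_op (Some j) (enum 'I_n) s f y.

Definition cell y s : set V := [set z | forall j, y 0 j <= z 0 j <= y 0 j + s 0 j].

Lemma bmean_half s f y j : pos_sides s -> lipschitz f ->
  bmean s f y = 2^-1 * (bmean (halve s j) f y
                        + bmean (halve s j) f (y + (s 0 j / 2) *: e j)).
Proof. by move=> s0 lf; apply: box_op_half; rewrite ?enum_uniq ?mem_enum. Qed.

Lemma bgrad_half s f y j : pos_sides s -> lipschitz f ->
  bgrad s f y = 2^-1 *: (bgrad (halve s j) f y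
                        + bgrad (halve s j) f (y + (s 0 j / 2) *: e j)).
Proof.
move=> s0 lf; apply/rowP => i; rewrite !mxE.
by apply: box_op_half; rewrite ?enum_uniq ?mem_enum.
Qed.

Lemma bgrad_norm s K f y : pos_sides s -> lip K f -> `|bgrad s f y| <= K.
Proof.
move=> s0 lf; apply: rV_norm_le => [|j]; first by case: lf.
by rewrite mxE box_diff_norm// ?enum_uniq ?mem_enum.
Qed.

Lemma cell_shift s y a : (forall i, 0 <= a 0 i <= if i \in enum 'I_n then s 0 i else 0) ->
  cell y s (y + a).
Proof.
move=> h j; have := h j; rewrite mem_enum mxE => /andP[? ?].
by rewrite lerDl lerD2l; apply/andP.
Qed.

Lemma bmean_near s f y c eps : pos_sides s -> lipschitz f ->
  (forall z, cell y s z -> `|f z - c| <= eps) -> `|bmean s f y - c| <= eps.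
Proof.
move=> s0 lf h.
have -> : bmean s f y - c = bmean s (fun u => 1 * f u + (- c)) y.
  by rewrite /bmean box_op_comb// ?box_mean_cst ?mul1r//; exact: lipschitz_cst.
rewrite -[leRHS]mul1r -[X in _ <= X * _](op_weight_None (enum 'I_n) s).
apply: box_op_norm; rewrite ?enum_uniq//.
  by apply: lipschitz_comb => //; exact: lipschitz_cst.
by move=> a ha; rewrite /= mul1r; apply: h; exact: cell_shift.
Qed.

(** The gradient of the mean of an affine function is its slope, so a function
    within eps of it on the cell has a mean whose slope differs by
    at most 2 eps / s_j. *)
Lemma bgrad_near s f y p c j eps : pos_sides s -> lipschitz f ->
  (forall z, cell y s z -> `|f z - (c + dotp p z)| <= eps) ->
  `|bgrad s f y 0 j - p 0 j| <= 2 / s 0 j * eps.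
Proof.
move=> s0 lf h.
have lp : lipschitz (fun y => c + dotp p y) by eexists; exact: dotp_lip.
have -> : bgrad s f y 0 j - p 0 j =
    box_op (Some j) (enum 'I_n) s (fun u => (-1) * (c + dotp p u) + f u) y.
  rewrite mxE box_op_comb// box_diff_affine ?enum_uniq ?mem_enum//.
  by rewrite mulN1r addrC.
rewrite -(op_weight_Some j s).
apply: box_op_norm; rewrite ?enum_uniq//.
  exact: lipschitz_comb.
by move=> a ha; rewrite /= mulN1r addrC; apply: h; exact: cell_shift.
Qed.

Lemma bmean_grad s f y : pos_sides s -> lipschitz f ->
  differentiable (bmean s f) y /\ grad (bmean s f) y = bgrad s f y.
Proof.
move=> s0 [K lf]; have K0 : 0 <= K by case: lf.
have lf' : lipschitz f by exists K.
have : forall j, exists L, lip L (box_op (Some j) (enum 'I_n) s f).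
  by move=> j; exact: box_op_lipschitz.
move=> /choice[L lL].
apply: (@diff_partial _ _ _ (fun j => box_op (Some j) (enum 'I_n) s f)
  (\sum_j 2 * K / s 0 j) (\sum_j L j)).
- by apply: sumr_ge0 => j _; apply: divr_ge0; [exact: mulr_ge0|exact: ltW].
- move=> j; have L0 i : 0 <= L i by have [] := lL i.
  split; first by apply: sumr_ge0.
  move=> u v; have [_ h] := lL j; apply: le_trans (h u v) _.
  rewrite ler_wpM2r// (bigD1 j)//= lerDl; exact: sumr_ge0.
move=> u j h h0.
have ul := enum_uniq 'I_n; have jl := mem_enum 'I_n j.
apply: le_trans (box_mean_deriv u s0 lf ul jl h0) _.
rewrite ler_wpM2r ?sqr_ge0// (bigD1 j)//= lerDl.
by apply: sumr_ge0 => i _; apply: divr_ge0; [exact: mulr_ge0|exact: ltW].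
Qed.

Lemma bgrad_continuous s f : pos_sides s -> lipschitz f -> continuous (bgrad s f).
Proof.
move=> s0 lf; apply: rV_continuous => j.
have -> : (fun x => bgrad s f x 0 j) = box_op (Some j) (enum 'I_n) s f.
  by apply/funext => x; rewrite mxE.
by apply: lipschitz_continuous; exact: box_op_lipschitz.
Qed.

Lemma bmean_shift s f a : (forall y, f (y + a) = f y) ->
  forall y, bmean s f (y + a) = bmean s f y.
Proof.
move=> fa y; have := box_op_shift None (enum 'I_n) s f a.
by rewrite (_ : (fun y => _) = f) => [/(congr1 (@^~ y))|]//=; exact/funext.
Qed.

End BoxMean.

(** * Bisection of boxes and covers of null sets *)

Section Bisection.
Variables (R : realType) (n : nat).
Local Notation V := 'rV[R]_n.
Local Notation e j := (delta_mx 0 j : V).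
Implicit Types (y z a s p : V) (i j : 'I_n) (C K h c r eps : R).

Variables (Phi : V -> V -> R) (c : R).
Hypothesis Phi_half : forall y s j, pos_sides s ->
  Phi y s <= Num.max (Phi y (halve s j))
                     (Phi (y + (s 0 j / 2) *: e j) (halve s j)).

Lemma halve_allE (l : seq 'I_n) s i : uniq l ->
  (foldr (fun j s => halve s j) s l) 0 i = if i \in l then s 0 i / 2 else s 0 i.
Proof.
elim: l => //= j l IH /andP[jl ul]; rewrite mxE inE IH//.
by have [->|ij] := eqVneq i j; rewrite ?(negbTE jl).
Qed.

(** One side is halved at a time, in each case keeping a half where Phi exceeds c. *)
Lemma bisect_axes (l : seq 'I_n) s y : uniq l -> pos_sides s -> c < Phi y s ->
  exists2 y', c < Phi y' (foldr (fun j s => halve s j) s l) &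
    forall j, y 0 j <= y' 0 j <= y 0 j + (if j \in l then s 0 j / 2 else 0).
Proof.
move=> ul s0 cy; elim: l ul => [_|j l IH /andP[jl ul]].
  by exists y => // j; rewrite addr0 lexx.
have [y' cy' hy'] := IH ul; set s' := foldr _ s l in cy'.
have s'0 : pos_sides s'.
  by move=> i; rewrite halve_allE//; case: ifP => // _; rewrite divr_gt0.
have s'j : s' 0 j = s 0 j by rewrite halve_allE// (negbTE jl).
have := lt_le_trans cy' (Phi_half y' j s'0); rewrite lt_max => /orP[cz|cz].
  exists y' => // i; have := hy' i; rewrite inE.
  have [->|//] := eqVneq i j; rewrite (negbTE jl)/= => /andP[-> /le_trans]; apply.
  by rewrite lerD2l divr_ge0// ltW.
exists (y' + (s' 0 j / 2) *: e j) => // i; have := hy' i; rewrite inE !mxE eqxx/=.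
have [->|ij] := eqVneq i j; last by rewrite mulr0 addr0.
rewrite (negbTE jl) s'j mulr1 addr0/= => /andP[h1 h2].
by have := s0 j => h3; apply/andP; split; lra.
Qed.

Lemma bisect_cell s y : pos_sides s -> c < Phi y s ->
  exists2 y', c < Phi y' (2^-1 *: s) &
    forall j, y 0 j <= y' 0 j /\ y' 0 j + 2^-1 * s 0 j <= y 0 j + s 0 j.
Proof.
move=> s0 cy; have [y' h1 h2] := bisect_axes (enum_uniq 'I_n) s0 cy.
exists y'.
  rewrite (_ : 2^-1 *: s = foldr (fun j s => halve s j) s (enum 'I_n))//.
  by apply/rowP => i; rewrite halve_allE ?enum_uniq// mem_enum mxE mulrC.
by move=> j; have := h2 j; rewrite mem_enum/= => /andP[? ?]; split; lra.
Qed.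

(** The corners of the nested cells increase in each coordinate, and their suprema
    give the common point z. *)
Lemma bisection s y : pos_sides s -> c < Phi y s ->
  exists (z : V) (Y : nat -> V),
    [/\ cell y s z,
        forall k, c < Phi (Y k) (2^-1 ^+ k *: s) &
        forall k, cell (Y k) (2^-1 ^+ k *: s) z].
Proof.
move=> s0 cy.
have sk0 k : pos_sides (2^-1 ^+ k *: s).
  by move=> j; rewrite mxE mulr_gt0// exprn_gt0// invr_gt0.
have : forall ky : nat * V, exists y' : V, c < Phi ky.2 (2^-1 ^+ ky.1 *: s) ->
   c < Phi y' (2^-1 ^+ ky.1.+1 *: s) /\
   forall j, ky.2 0 j <= y' 0 j /\
     y' 0 j + 2^-1 ^+ ky.1.+1 * s 0 j <= ky.2 0 j + 2^-1 ^+ ky.1 * s 0 j.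
  case=> k y1 /=; have [cy1|] := boolP (c < Phi y1 (2^-1 ^+ k *: s)); last by exists y1.
  have [y' h1 h2] := bisect_cell (sk0 k) cy1.
  exists y' => _; rewrite exprS -scalerA; split => // j.
  by have := h2 j; rewrite !mxE mulrA.
move=> /choice[F hF].
pose Y := fix Y k := if k is k'.+1 then F (k', Y k') else y.
have cY k : c < Phi (Y k) (2^-1 ^+ k *: s).
  by elim: k => [|k IH]; [rewrite expr0 scale1r|have [] := hF (k, Y k) IH].
have hY k j := (hF (k, Y k) (cY k)).2 j.
have up k l j : (k <= l)%N -> Y k 0 j <= Y l 0 j /\
    Y l 0 j + 2^-1 ^+ l * s 0 j <= Y k 0 j + 2^-1 ^+ k * s 0 j.
  move=> /subnKC <-; elim: (l - k)%N => [|d [h1 h2]]; first by rewrite addn0.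
  have [/= h3 h4] := hY (k + d)%N j; rewrite addnS; split.
    exact: le_trans h1 h3.
  exact: le_trans h4 h2.
have ub k l j : Y l 0 j <= Y k 0 j + 2^-1 ^+ k * s 0 j.
  have [kl|lk] := leqP k l.
    have [_ h] := up k l j kl; apply: le_trans h; rewrite lerDl.
    by rewrite mulr_ge0 ?exprn_ge0 ?invr_ge0// ltW.
  have [h _] := up l k j (ltnW lk); apply: le_trans h _; rewrite lerDl.
  by rewrite mulr_ge0 ?exprn_ge0 ?invr_ge0// ltW.
pose z : V := \row_j sup [set Y k 0 j | k in [set: nat]].
have zE k : cell (Y k) (2^-1 ^+ k *: s) z.
  move=> j; rewrite [z 0 j]mxE [(_ *: s) 0 j]mxE; apply/andP; split.
    apply: sup_upper_bound; last by exists k.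
    split; first by exists (Y 0 0 j), 0.
    by exists (Y 0 0 j + 2^-1 ^+ 0 * s 0 j) => _ [l _ <-].
  apply: sup_le_ub; first by exists (Y 0 0 j), 0.
  by move=> _ [l _ <-].
exists z, Y; split => //.
by have := zE 0; rewrite expr0 scale1r.
Qed.

End Bisection.

Section Covering.
Variables (R : realType) (n : nat).
Local Notation V := 'rV[R]_n.
Local Notation e j := (delta_mx 0 j : V).
Implicit Types (y z a s p : V) (i j : 'I_n) (C K h r eps : R).

(** The overlap of [x, x + s] with [a, b] has length
    [clamp a b (x + s) - clamp a b x], which is plainly additive in the interval. *)
Definition clamp (a b x : R) : R := Num.min (Num.max x a) b.

Lemma clamp_le (a b x y : R) : x <= y -> clamp a b x <= clamp a b y.
Proof.
move=> xy; rewrite /clamp /Num.min /Num.max.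
by do !case: ifPn; rewrite -?leNgt => *; lra.
Qed.
Lemma clamp_bound (a b x : R) : a <= b -> a <= clamp a b x <= b.
Proof.
move=> xy; rewrite /clamp /Num.min /Num.max.
by do !case: ifPn; rewrite -?leNgt => *; lra.
Qed.
Lemma clamp_id (a b x : R) : a <= x <= b -> clamp a b x = x.
Proof.
move=> xy; rewrite /clamp /Num.min /Num.max.
by do !case: ifPn; rewrite -?leNgt => *; lra.
Qed.

(** The proportion of the cell that lies in the box c. *)
Definition box_share (c : V * V) y s : R :=
  \prod_j ((clamp (c.1 0 j) (c.2 0 j) (y 0 j + s 0 j)
            - clamp (c.1 0 j) (c.2 0 j) (y 0 j)) / s 0 j).

Lemma box_share_ge0 (c : V * V) y s : pos_sides s -> 0 <= box_share c y s.
Proof.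
move=> s0; apply: prodr_ge0 => j _; apply: divr_ge0; last exact: ltW.
by rewrite subr_ge0 clamp_le// lerDl ltW.
Qed.

Lemma box_share_le (c : V * V) y s : pos_sides s -> (forall j, c.1 0 j <= c.2 0 j) ->
  box_share c y s <= (\prod_j s 0 j)^-1 * box_volume c.
Proof.
move=> s0 c12; rewrite /box_volume -prodfV -big_split/=.
apply: ler_prod => j _; apply/andP; split.
  apply: divr_ge0; last exact: ltW.
  by rewrite subr_ge0 clamp_le// lerDl ltW.
rewrite mulrC ler_pM2l ?invr_gt0//.
have /andP[] := clamp_bound (y 0 j) (c12 j).
by have /andP[] := clamp_bound (y 0 j + s 0 j) (c12 j) => *; lra.
Qed.

Lemma box_share_eq1 (c : V * V) y s : pos_sides s -> cell y s `<=` box c -> box_share c y s = 1.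
Proof.
move=> s0 sub; rewrite /box_share big1// => j _.
have h1 : box c y by apply: sub => i; rewrite lexx lerDl ltW.
have h2 : box c (y + s) by apply: sub => i; rewrite mxE lexx lerDl ltW.
rewrite !clamp_id ?[_ + _ - _]addrC ?addKr ?divff ?gt_eqF//.
by have := h2 j; rewrite mxE.
Qed.

(** Only the factor of the axis j changes, and the overlaps of the two halves
    with the box add up. *)
Lemma box_share_half (c : V * V) y s j : pos_sides s ->
  box_share c y s = 2^-1 * (box_share c y (halve s j) +
                            box_share c (y + (s 0 j / 2) *: e j) (halve s j)).
Proof.
move=> s0; pose F y s i := (clamp (c.1 0 i) (c.2 0 i) (y 0 i + s 0 i)
            - clamp (c.1 0 i) (c.2 0 i) (y 0 i)) / s 0 i.
have E y' s' : (forall i, i != j -> F y' s' i = F y s i) ->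
    box_share c y' s' = F y' s' j * \prod_(i < n | i != j) F y s i.
  by move=> h; rewrite /box_share (bigD1 j)//=; congr (_ * _); exact: eq_bigr.
rewrite !E//; first last.
- by move=> i ij; rewrite /F !mxE (negbTE ij).
- by move=> i ij; rewrite /F !mxE (negbTE ij) andbF mulr0 addr0.
rewrite /F !mxE !eqxx/= mulr1.
have -> : y 0 j + s 0 j / 2 + s 0 j / 2 = y 0 j + s 0 j by lra.
by field; rewrite gt_eqF.
Qed.

(** The boxes are counted with multiplicity, which keeps the share of a cell
    equal to the average of the shares of its halves. *)
Definition cover_share (c : nat -> V * V) y s : R :=
  fine (\sum_(0 <= k <oo) (box_share (c k) y s)%:E)%E.

End Covering.

Section CoverShare.
Variables (R : realType) (n : nat).
Local Notation V := 'rV[R]_n.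
Local Notation e j := (delta_mx 0 j : V).
Implicit Types (y z a s p : V) (i j : 'I_n) (C K h r eps : R).

Section fixed_cover.
Variables (c : nat -> V * V) (eps : R).
Hypothesis c12 : forall k j, (c k).1 0 j <= (c k).2 0 j.
Hypothesis ceps : (\sum_(0 <= k <oo) (box_volume (c k))%:E <= eps%:E)%E.

Lemma box_volume_ge0 k : 0 <= box_volume (c k).
Proof. by apply: prodr_ge0 => j _; rewrite subr_ge0. Qed.

Lemma cover_share_series y s : pos_sides s ->
  (\sum_(0 <= k <oo) (box_share (c k) y s)%:E <= ((\prod_j s 0 j)^-1 * eps)%:E)%E.
Proof.
move=> s0; have P0 : 0 <= (\prod_j s 0 j)^-1.
  by rewrite invr_ge0; apply: prodr_ge0 => j _; exact: ltW.
apply: (@le_trans _ _ (\sum_(0 <= k <oo) ((\prod_j s 0 j)^-1)%:E * (box_volume (c k))%:E)%E).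
  apply: lee_nneseries => k _; first by rewrite lee_fin box_share_ge0.
  by rewrite -EFinM lee_fin box_share_le.
rewrite nneseriesZl; last by move=> k _; rewrite lee_fin box_volume_ge0.
by rewrite EFinM lee_wpmul2l.
Qed.

Lemma cover_shareE y s : pos_sides s ->
  (cover_share c y s)%:E = (\sum_(0 <= k <oo) (box_share (c k) y s)%:E)%E.
Proof.
move=> s0; rewrite fineK// ge0_fin_numE.
  by apply: le_lt_trans (cover_share_series y s0) _; rewrite ltry.
by apply: nneseries_ge0 => k _ _; rewrite lee_fin box_share_ge0.
Qed.

Lemma cover_share_ge0 y s : pos_sides s -> 0 <= cover_share c y s.
Proof.
move=> s0; rewrite -lee_fin cover_shareE//.
by apply: nneseries_ge0 => k _ _; rewrite lee_fin box_share_ge0.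
Qed.

Lemma cover_share_le y s : pos_sides s -> cover_share c y s <= (\prod_j s 0 j)^-1 * eps.
Proof. by move=> s0; rewrite -lee_fin cover_shareE// cover_share_series. Qed.

Lemma cover_share_ge1 y s k : pos_sides s -> cell y s `<=` box (c k) ->
  1 <= cover_share c y s.
Proof.
move=> s0 sub; rewrite -lee_fin cover_shareE//.
rewrite (@nneseriesD1 _ _ k)//.
  rewrite box_share_eq1// leeDl//.
  by apply: nneseries_ge0 => l _ _; rewrite lee_fin box_share_ge0.
by move=> l _; rewrite lee_fin box_share_ge0.
Qed.

Lemma cover_share_half y s j : pos_sides s ->
  cover_share c y s = 2^-1 * (cover_share c y (halve s j) +
                            cover_share c (y + (s 0 j / 2) *: e j) (halve s j)).
Proof.
move=> s0; have s'0 := halve_pos j s0; apply: EFin_inj.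
rewrite EFinM EFinD !cover_shareE// -nneseriesD//; first last.
- by move=> k _ _; rewrite lee_fin box_share_ge0.
- by move=> k _ _; rewrite lee_fin box_share_ge0.
rewrite -nneseriesZl; last first.
  by move=> k _; rewrite -EFinD lee_fin addr_ge0// box_share_ge0.
by apply: eq_eseriesr => k _; rewrite -EFinD -EFinM (box_share_half _ _ j s0).
Qed.

End fixed_cover.

(** The volume is continuous in the corners. *)
Lemma enlarge_volume (c : V * V) eps : 0 < eps ->
  exists2 t : R, 0 < t &
    box_volume (c.1 - const_mx t, c.2 + const_mx t) <= box_volume c + eps.
Proof.
move=> eps0; pose P (l : seq 'I_n) (t : R) :=
  \prod_(j <- l) ((c.2 0 j + t) - (c.1 0 j - t)).
have cP l : continuous (P l).
  elim: l => [|j l IH].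
    rewrite (_ : P [::] = fun=> 1); first by move=> t; exact: cst_continuous.
    by apply/funext => u; rewrite /P big_nil.
  rewrite (_ : P _ = fun u : R => ((c.2 0 j + u) - (c.1 0 j - u)) * P l u).
    move=> t; apply: (@continuousM R R (fun u : R => (c.2 0 j + u) - (c.1 0 j - u)) (P l)); last exact: IH.
    apply: continuousB; first by apply: continuousD; [exact: cst_continuous|exact: cvg_id].
    by apply: continuousB; [exact: cst_continuous|exact: cvg_id].
  by apply/funext => u; rewrite /P big_cons.
have /continuous_at_normP /(_ eps eps0)[d d0 h] := cP (index_enum 'I_n) 0.
exists (d / 2); first by rewrite divr_gt0.
have := h (d / 2); rewrite sub0r normrN gtr0_norm ?divr_gt0//.
have d2 : d / 2 < d by lra.
move=> /(_ d2).
rewrite /box_volume /= ltr_norml => /andP[h1 _].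
rewrite [leLHS](_ : _ = P (index_enum 'I_n) (d / 2)); last first.
  by apply: eq_bigr => j _; rewrite !mxE.
rewrite [X in _ <= X + _](_ : _ = P (index_enum 'I_n) 0); first by lra.
by apply: eq_bigr => j _; rewrite addr0 subr0.
Qed.

(** Closed boxes covering N are enlarged a little so that N lies in their
    interiors: a small cell around a point of N is then inside one of them. *)
Lemma null_cover (N : set V) eps : lebesgue_outer N = 0%E -> 0 < eps ->
  exists c : nat -> V * V,
    [/\ forall k j, (c k).1 0 j <= (c k).2 0 j,
        (\sum_(0 <= k <oo) (box_volume (c k))%:E <= eps%:E)%E &
        forall z, N z -> exists k, forall j, (c k).1 0 j < z 0 j < (c k).2 0 j].
Proof.
move=> N0 eps0.
have e20 : 0 < eps / 2 by rewrite divr_gt0.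
have : (lebesgue_outer N < (eps / 2)%:E)%E by rewrite N0 lte_fin.
move=> /ereal_inf_lt[_ [c [c12 Nc] <-] hc].
have : forall k, exists t : R, 0 < t /\
    box_volume ((c k).1 - const_mx t, (c k).2 + const_mx t) <=
    box_volume (c k) + (eps / 2) / (2 ^ k.+1)%:R.
  move=> k; have [|t t0 ht] := @enlarge_volume (c k) ((eps / 2) / (2 ^ k.+1)%:R).
    by rewrite divr_gt0// ltr0n expn_gt0.
  by exists t.
move=> /choice[t ht].
exists (fun k => ((c k).1 - const_mx (t k), (c k).2 + const_mx (t k))).
have c12' k j : (c k).1 0 j - t k <= (c k).2 0 j + t k.
  by have := c12 k j; have [] := ht k => *; lra.
split => /=.
- by move=> k j; rewrite !mxE.
- apply: (@le_trans _ _ (\sum_(0 <= k <oo)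
     ((box_volume (c k))%:E + ((eps / 2) / (2 ^ k.+1)%:R)%:E))%E).
    apply: lee_nneseries => k _.
      move=> _; rewrite lee_fin /box_volume /=; apply: prodr_ge0 => j _.
      by rewrite !mxE subr_ge0.
    by rewrite -EFinD lee_fin; have [] := ht k.
  apply: le_trans (epsilon_trick _ _ (ltW e20)) _.
    by move=> k; rewrite lee_fin box_volume_ge0.
  rewrite [eps in leRHS](splitr eps) EFinD leeD2r//; exact: ltW.
move=> z /Nc[k _ hz]; exists k => j; rewrite !mxE.
by have := hz j; have [t0 _] := ht k => /andP[? ?]; apply/andP; split; lra.
Qed.

End CoverShare.

(** * Jensen's inequality for means over cubes *)

Lemma half_pow_small (R : realType) (r d : R) : 0 < d -> exists k, 2^-1 ^+ k * r < d.
Proof.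
move=> d0; exists (Num.bound (r / d)).
rewrite exprVn mulrC ltr_pdivrMr ?exprn_gt0// -ltr_pdivrMl// mulrC.
have [rd|rd] := leP 0 (r / d); last first.
  by apply: lt_le_trans rd _; rewrite exprn_ge0.
apply: lt_le_trans (archi_boundP rd) _.
by rewrite -natrX ler_nat ltnW// ltn_expl.
Qed.

Lemma compact_norm_le (R : realType) n (B : R) :
  compact [set p : 'rV[R]_n | `|p| <= B].
Proof.
apply: bounded_closed_compact.
  by exists B; split; [exact: num_real|move=> M BM p /= /le_trans; apply; exact: ltW].
rewrite (_ : [set p | _] = (fun p : 'rV[R]_n => `|p|) @^-1` [set x | x <= B]).
  apply: closed_comp; last exact: closed_le.
  by move=> p _; exact: norm_continuous.
by [].
Qed.

Lemma continuous_bounded_ball (R : realType) n m (F : 'rV[R]_n * 'rV[R]_m -> R)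
    (A B : R) : 0 <= A -> 0 <= B -> continuous F ->
  exists M : R, forall p u, `|p| <= A -> `|u| <= B -> F (p, u) <= M.
Proof.
move=> A0 B0 cF.
have cK := compact_setX (@compact_norm_le R n A) (@compact_norm_le R m B).
have [|w _ h] := compact_EVT_max _ cK (continuous_subspaceT cF).
  by exists (0, 0); split; rewrite /= normr0.
by exists (F w) => p u pA uB; apply: h; rewrite inE.
Qed.

Section Mollified.
Variables (R : realType) (n m : nat).
Local Notation V := 'rV[R]_n.
Local Notation U := 'rV[R]_m.
Local Notation e j := (delta_mx 0 j : V).
Implicit Types (y z s p : V) (C K h r eps : R) (a : 'I_m) (j : 'I_n).

Variables (fs : 'I_m -> V -> R) (i : 'I_m) (K M : R).
Hypothesis fs_lip : forall a, lip K (fs a).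
Hypothesis fs_bound : forall a y, `|fs a y| <= M.

(** The argument (p, u) of the i-th Hamiltonian when the means replace the
    functions. *)
Definition jet y s : V * U := (bgrad s (fs i) y, \row_a bmean s (fs a) y).

Let fs_lipschitz a : lipschitz (fs a). Proof. by exists K. Qed.

Lemma jet_half y s j : pos_sides s ->
  jet y s = 2^-1 *: (jet y (halve s j) + jet (y + (s 0 j / 2) *: e j) (halve s j)).
Proof.
move=> s0; rewrite /jet; congr pair; first exact: bgrad_half.
by apply/rowP => a; rewrite !mxE; exact: bmean_half.
Qed.

Lemma fs_bound_ge0 : 0 <= M.
Proof. exact: le_trans (normr_ge0 _) (fs_bound i 0). Qed.

Lemma bmean_bound y s a : pos_sides s -> `|bmean s (fs a) y| <= M.
Proof.
move=> s0; rewrite -[bmean _ _ _]subr0; apply: bmean_near => // z _.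
by rewrite subr0.
Qed.

(** The deviation of the i-th component from its first-order expansion is o(r) on
    a cube of side r containing z, and [bgrad_near] divides it by r. *)
Lemma jet_limit z eps : differentiable (fs i) z -> 0 < eps ->
  exists2 d : R, 0 < d & forall y r, 0 < r -> r < d -> cell y (const_mx r) z ->
    `|(grad (fs i) z, \row_a fs a z) - jet y (const_mx r)| < eps.
Proof.
move=> df eps0; have eta0 : 0 < eps / 4 by rewrite divr_gt0.
have [d d0 H] := grad_approx df eta0.
have K0 : 0 <= K by have [] := fs_lip i.
have K1 : 0 < K + 1 by rewrite ltr_wpDl.
exists (Num.min d (eps / 4 / (K + 1))).
  by rewrite lt_min d0 divr_gt0.
move=> y r r0; rewrite lt_min => /andP[rd rK] yz.
have s0 : pos_sides (const_mx r : V) by move=> j; rewrite mxE.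
have near_z z' : cell y (const_mx r) z' -> `|z' - z| <= r.
  move=> yz'; apply: rV_norm_le => [|j]; first exact: ltW.
  have := yz j; have := yz' j; rewrite !mxE => /andP[? ?] /andP[? ?].
  by rewrite ler_norml; apply/andP; split; lra.
apply: (@le_lt_trans _ _ (eps / 2)); last by lra.
have e2 : 0 <= eps / 2 by lra.
rewrite [leLHS]/Num.norm/= ge_max; apply/andP; split; apply: rV_norm_le => // j.
  rewrite [X in `|X|](_ : _ = grad (fs i) z 0 j - bgrad (const_mx r) (fs i) y 0 j); last first.
    by rewrite [LHS]mxE [X in _ + X]mxE.
  rewrite distrC.
  have -> : eps / 2 = 2 / (const_mx r : V) 0 j * (eps / 4 * r).
    by rewrite mxE; field; rewrite gt_eqF.
  apply: (@bgrad_near _ _ _ _ _ _ (fs i z - dotp (grad (fs i) z) z)) => // z' yz'.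
  have zz' := near_z z' yz'.
  have := H (z' - z) (le_lt_trans zz' rd); rewrite subrK dotpBr.
  have -> : fs i z' - fs i z - (dotp (grad (fs i) z) z' - dotp (grad (fs i) z) z)
    = fs i z' - (fs i z - dotp (grad (fs i) z) z + dotp (grad (fs i) z) z') by ring.
  by move=> /le_trans; apply; rewrite ler_wpM2l// ltW.
rewrite !mxE distrC.
apply: bmean_near => // z' yz'; have [_ lj] := fs_lip j.
apply: le_trans (lj _ _) _.
apply: (@le_trans _ _ ((K + 1) * r)).
  by apply: ler_pM => //; [rewrite lerDl|exact: near_z].
by move: rK; rewrite ltr_pdivlMr// mulrC => h; lra.
Qed.

Variable F : V * U -> R.
Hypothesis F_cont : continuous F.
Hypothesis F_convex : forall w w', F (2^-1 *: (w + w')) <= 2^-1 * (F w + F w').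

(** Jensen's inequality by bisection.  If F exceeded c at the jet over the cube,
    so would Phi = F(jet) - A share, where share is the proportion of a cell
    covered by boxes around N of tiny total volume.  Convexity of F lets Phi exceed
    c + eta on cells shrinking to a point z.  If z is in N, a small cell is inside
    one of the boxes, its share is at least 1, and A was chosen so large that
    Phi <= c there.  Otherwise the jets tend to the jet of the functions at z, where
    F <= c. *)
Lemma mollified_bound (N : set V) (c r : R) y0 :
  lebesgue_outer N = 0%E -> 0 < r ->
  (forall z, cell y0 (const_mx r) z -> ~ N z ->
     differentiable (fs i) z /\ F (grad (fs i) z, \row_a fs a z) <= c) ->
  F (jet y0 (const_mx r)) <= c.
Proof.
move=> N0 r0 good; rewrite leNgt; apply/negP => cF.
have s0 : pos_sides (const_mx r : V) by move=> j; rewrite mxE.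
have K0 : 0 <= K by have [] := fs_lip i.
have [B hB] := continuous_bounded_ball K0 fs_bound_ge0 F_cont.
have jB y s : pos_sides s -> F (jet y s) <= B.
  move=> s0'; apply: hB; first exact: bgrad_norm.
  by apply: rV_norm_le => [|a]; [exact: fs_bound_ge0|rewrite mxE bmean_bound].
(* B bounds F at the jets of all cells *)
pose A := Num.max 0 (B - c).
have A0 : 0 <= A by rewrite /A le_max lexx.
have AB : B - c <= A by rewrite /A le_max lexx orbT.
pose P := (\prod_(j < n) (const_mx r : V) 0 j)^-1.
have P0 : 0 < P by rewrite invr_gt0; apply: prodr_gt0 => j _; rewrite mxE.
pose eta := (F (jet y0 (const_mx r)) - c) / 2.
have eta0 : 0 < eta by rewrite divr_gt0// subr_gt0.
have A1 : 0 < A + 1 by rewrite ltr_wpDl.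
(* total volume of the cover, so that A times its share of the cube is below eta *)
have eps0 : 0 < eta / (A + 1) / P by apply: divr_gt0 => //; exact: divr_gt0.
have [cov [c12 ceps Ncov]] := null_cover N0 eps0.
pose Phi y s := F (jet y s) - A * cover_share cov y s.
have Phi0 : c + eta < Phi y0 (const_mx r).
  rewrite /Phi; have := cover_share_le c12 ceps y0 s0.
  rewrite -/P mulrCA mulfV ?gt_eqF// mulr1 => h.
  have := ler_wpM2l A0 h.
  have : A * (eta / (A + 1)) < eta.
    by rewrite mulrCA gtr_pMr// ltr_pdivrMr// mul1r ltrDl.
  by rewrite /eta => h1 h2; lra.
have Phi_half y s j : pos_sides s -> Phi y s <= Num.max (Phi y (halve s j))
                     (Phi (y + (s 0 j / 2) *: e j) (halve s j)).
  move=> s0'; rewrite {1}/Phi (jet_half _ j s0') (cover_share_half c12 ceps _ j s0').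
  set w1 := jet _ _; set w2 := jet _ _.
  set u1 := cover_share _ _ _; set u2 := cover_share _ _ _.
  have h := F_convex w1 w2.
  have h1 : Phi y (halve s j) = F w1 - A * u1 by [].
  have h2 : Phi (y + (s 0 j / 2) *: e j) (halve s j) = F w2 - A * u2 by [].
  rewrite h1 h2 le_max; have [k|k] := leP (F w1 - A * u1) (F w2 - A * u2).
    by apply/orP; right; lra.
  by apply/orP; left; lra.
have [z [Y [yz cY Yz]]] := bisection Phi_half s0 Phi0.
have sE k : 2^-1 ^+ k *: (const_mx r : V) = const_mx (2^-1 ^+ k * r).
  by apply/rowP => j; rewrite !mxE.
have rk0 k : 0 < 2^-1 ^+ k * r by rewrite mulr_gt0// exprn_gt0// invr_gt0.
have sk0 k : pos_sides (const_mx (2^-1 ^+ k * r) : V) by move=> j; rewrite mxE.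
have [/Ncov[l zl]|Nz] := pselect (N z).
  have : exists2 d : R, 0 < d & forall j, (cov l).1 0 j <= z 0 j - d /\ z 0 j + d <= (cov l).2 0 j.
    exists (\big[Num.min/1]_j Num.min (z 0 j - (cov l).1 0 j) ((cov l).2 0 j - z 0 j)).
      apply/bigmin_gtP; split => // j _.
      by have /andP[? ?] := zl j; rewrite lt_min !subr_gt0; apply/andP.
    move=> j; have : \big[Num.min/1]_j Num.min (z 0 j - (cov l).1 0 j) ((cov l).2 0 j - z 0 j)
      <= Num.min (z 0 j - (cov l).1 0 j) ((cov l).2 0 j - z 0 j) by exact: bigmin_le.
    by rewrite le_min => /andP[? ?]; split; lra.
  move=> [d d0 hd]; have [k hk] := half_pow_small r d0.
  have := cY k; rewrite sE /Phi ltNge => /negP; apply.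
  have sub : cell (Y k) (const_mx (2^-1 ^+ k * r)) `<=` box (cov l).
    move=> z' yz' j; have := yz' j; have := Yz k j; rewrite sE !mxE.
    have [? ?] := hd j => /andP[? ?] /andP[? ?].
    by apply/andP; split; lra.
  have := cover_share_ge1 c12 ceps (sk0 k) sub.
  have := jB (Y k) _ (sk0 k) => h1 h2.
  by have := ler_wpM2l A0 h2; lra.
have [df Fz] := good z yz Nz.
have cz : {for (grad (fs i) z, \row_a fs a z), continuous F} by exact: F_cont.
have /continuous_at_normP /(_ eta eta0)[d d0 hF] := cz.
have [d' d'0 hJ] := jet_limit df d0.
have [k hk] := half_pow_small r d'0.
have := cY k; rewrite sE /Phi.
have := Yz k; rewrite sE => Yzk.
have := hF _ (hJ _ _ (rk0 k) hk Yzk).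
have := mulr_ge0 A0 (cover_share_ge0 c12 ceps (Y k) (sk0 k)).
rewrite ltr_norml => h1 /andP[h2 h3] h4.
clear ceps N0 hF; lra.
Qed.

End Mollified.

(** * Periodic functions and functions on the torus *)

Section TorusLift.
Variables (R : realType) (n : nat).
Local Notation V := 'rV[R]_n.
Local Notation e j := (delta_mx 0 j : V).
Local Notation T := (torus R n).
Local Notation pit := (\pi_(torus R n) : V -> torus R n).

(** Functions on the torus are handled through their Z^n-periodic lifts to R^n. *)
Definition lattice_periodic (S : Type) (f : V -> S) :=
  forall y y', lattice_eq y y' -> f y = f y'.

Lemma pi_eq (y y' : V) : lattice_eq y y' -> pit y = pit y'.
Proof. by move=> yy'; apply/eqmodP. Qed.

Lemma pi_repr (y : V) : lattice_eq (repr (pit y)) y.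
Proof. by have := reprK (pit y); move/eqmodP. Qed.

Lemma pi_surj (x : T) : pit (repr x) = x.
Proof. exact: reprK. Qed.

Lemma tlift_periodic (S : Type) (f : T -> S) : lattice_periodic (tlift f).
Proof. by move=> y y' yy'; rewrite /tlift (pi_eq yy'). Qed.

Lemma tlift_descend (S : Type) (f : V -> S) : lattice_periodic f ->
  tlift (fun x : T => f (repr x)) = f.
Proof. by move=> pf; apply/funext => y; apply: pf; exact: pi_repr. Qed.

Lemma lattice_eq_shift (y y' a : V) :
  lattice_eq y y' -> lattice_eq (y + a) (y' + a).
Proof.
move=> /forallP h; apply/forallP => j; have := h j.
by rewrite !mxE opprD addrACA subrr addr0.
Qed.

(** The derivatives of a function on the torus are defined at the chosen
    representative; this moves them to any other one. *)
Lemma periodic_diff (f : V -> R) y y' : lattice_periodic f -> lattice_eq y y' ->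
  differentiable f y -> differentiable f y' /\ grad f y' = grad f y.
Proof.
move=> pf yy' df; apply: diff_gradP => eps eps0.
have [d d0 H] := grad_approx df eps0; exists d => // h hd.
have := H h hd; rewrite (pf _ _ yy').
suff -> : f (h + y) = f (h + y') by [].
by rewrite ![h + _]addrC; apply: pf; exact: lattice_eq_shift.
Qed.

Lemma periodic_continuous (Z : topologicalType) (f : V -> Z) :
  lattice_periodic f -> continuous f -> continuous (fun x : T => f (repr x)).
Proof.
move=> pf cf; apply/quotient_continuous.
by rewrite (_ : _ \o _ = f)//; exact: (tlift_descend pf).
Qed.

Lemma tlift_continuous (Z : topologicalType) (f : T -> Z) :
  continuous f -> continuous (tlift f).
Proof. by move=> cf; apply/quotient_continuous. Qed.

Lemma pi_torus_continuous : continuous pit.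
Proof. exact: pi_continuous. Qed.

Lemma tC1_descend (f : V -> R) : lattice_periodic f ->
  (forall y, differentiable f y) -> continuous (grad f) ->
  tC1 (fun x : T => f (repr x)) /\
  forall y, tgrad (fun x : T => f (repr x)) (pit y) = grad f y.
Proof.
move=> pf df cf; rewrite /tC1 /tdifferentiable /tgrad (tlift_descend pf).
have pg : lattice_periodic (grad f).
  by move=> y y' yy'; have [_ ->] := periodic_diff pf yy' (df y).
split; first by split => //; exact: periodic_continuous.
by move=> y; apply: pg; exact: pi_repr.
Qed.

Lemma lattice_near (z y : V) : exists y', lattice_eq y' y /\
  forall j, `|y' 0 j - z 0 j| <= 2^-1.
Proof.
pose k j := Num.floor (y 0 j - z 0 j + 2^-1).
exists (\row_j (y 0 j - (k j)%:~R)); split.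
  by apply/forallP => j; rewrite mxE addrAC subrr add0r rpredN intr_int.
move=> j; rewrite mxE.
have h1 := floor_le (y 0 j - z 0 j + 2^-1).
have h2 := floorD1_gt (y 0 j - z 0 j + 2^-1).
by rewrite ler_norml; apply/andP; split; rewrite /k; rewrite intrD in h2; lra.
Qed.

Lemma torus_compact : compact [set: T].
Proof.
rewrite (_ : [set: T] = pit @` [set y | `|y| <= 2^-1]).
  apply: continuous_compact; last exact: compact_norm_le.
  by apply: continuous_subspaceT; exact: pi_torus_continuous.
apply/seteqP; split => // x _.
have [y [yx hy]] := lattice_near 0 (repr x).
exists y; last by rewrite (pi_eq yx) pi_surj.
apply: rV_norm_le => // j; have := hy j; by rewrite mxE subr0.
Qed.

Lemma periodic_max (f : V -> R) : lattice_periodic f -> continuous f ->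
  exists y, forall y', f y' <= f y.
Proof.
move=> pf cf.
have [|x _ h] := compact_EVT_max _ torus_compact
  (continuous_subspaceT (periodic_continuous pf cf)).
- by exists (pit 0).
exists (repr x) => y'; have := h (pit y'); rewrite inE => /(_ Logic.I).
by rewrite (pf _ _ (pi_repr y')).
Qed.

End TorusLift.

(** * Trigonometric test functions *)

Section Trig.
Variable R : realType.
Implicit Types (a t x u A p delta : R) (k : int).

Definition sinpi a t : R := sin (pi * (t - a)).
Definition cospi a t : R := cos (pi * (t - a)).

Lemma is_derive_affine (c a t : R) : is_derive t 1 (fun t : R => c * (t - a)) c.
Proof.
have h : is_derive t 1 (fun t : R => t - a) 1.
  by rewrite -[X in is_derive _ _ _ X]subr0; exact: is_deriveB.
have := @is_deriveZ _ _ _ (fun t : R => t - a) c t 1 1 h.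
by rewrite [X in is_derive _ _ _ X](_ : _ = c) //; rewrite /GRing.scale/= mulr1.
Qed.

Lemma is_derive_sinpi a t : is_derive t 1 (sinpi a) (pi * cospi a t).
Proof.
rewrite mulrC; apply: (@is_derive1_comp _ sin (fun t => pi * (t - a))).
exact: is_derive_affine.
Qed.

Lemma is_derive_sinpi2 a t :
  is_derive t 1 (fun t => sinpi a t ^+ 2) (2 * sinpi a t * (pi * cospi a t)).
Proof.
have h := is_derive_sinpi a t.
rewrite [X in is_derive _ _ X _](_ : _ = (sinpi a : R -> R) * (sinpi a : R -> R)); last first.
  by apply/funext => u; rewrite expr2.
by apply: is_derive_eq; rewrite /GRing.scale/=; ring.
Qed.

Lemma cospi_continuous (c a : R) : continuous (fun t : R => cos (c * (t - a))).
Proof.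
move=> t; apply: (@continuous_comp _ _ _ (fun t : R => c * (t - a)) cos).
  apply: continuousM; first exact: cst_continuous.
  by apply: continuousB; [exact: cvg_id|exact: cst_continuous].
exact: continuous_cos.
Qed.

Lemma sinpi_continuous (c a : R) : continuous (fun t : R => sin (c * (t - a))).
Proof.
move=> t; apply: (@continuous_comp _ _ _ (fun t : R => c * (t - a)) sin).
  apply: continuousM; first exact: cst_continuous.
  by apply: continuousB; [exact: cvg_id|exact: cst_continuous].
exact: continuous_sin.
Qed.

Lemma int_periodic (S : Type) (g : R -> S) : (forall t, g (t + 1) = g t) ->
  forall t k, g (t + k%:~R) = g t.
Proof.
move=> g1; have gn t (n : nat) : g (t + n%:R) = g t.
  by elim: n => [|n IH]; [rewrite addr0|rewrite -natr1 addrA g1].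
move=> t [n|n]; first exact: gn.
by rewrite NegzE mulrNz -(gn (t - _) n.+1) subrK.
Qed.

Lemma sinpi_sqr_periodic a t : sinpi a (t + 1) ^+ 2 = sinpi a t ^+ 2.
Proof.
rewrite /sinpi (_ : pi * (t + 1 - a) = pi * (t - a) + pi); last by ring.
by rewrite sinDpi sqrrN.
Qed.

Lemma sin_le_id x : `|sin x| <= `|x|.
Proof.
have pos_case u : 0 <= u -> `|sin u| <= u.
  move=> u0; have [c _] := @mean_value _ sin cos 0 u u0 _.
  rewrite sin0 !subr0 => ->; rewrite normrM (ger0_norm u0).
  by rewrite ler_piMl// cos_max.
have [x0|x0] := leP 0 x; first by rewrite (ger0_norm x0); exact: pos_case.
by rewrite (ltr0_norm x0) -normrN -sinN; apply: pos_case; rewrite oppr_ge0 ltW.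
Qed.

Lemma cos_near1 x : `|cos x - 1| <= `|x|.
Proof.
have -> : cos x - 1 = - (2 * sin (x / 2) ^+ 2).
  rewrite {1}(_ : x = (x / 2) *+ 2); last by rewrite mulr2n; lra.
  by rewrite cos_mulr2n cos2sin2 mulr2n; ring.
rewrite normrN normrM normrX ger0_norm// expr2.
have h := sin_le_id (x / 2).
have h1 := sin_max (x / 2).
have : `|x / 2| = `|x| / 2 by rewrite normrM normfV (ger0_norm (ler0n R 2)).
move=> e; rewrite e in h.
have := ler_wpM2l (normr_ge0 (sin (x / 2))) h1; lra.
Qed.

(** Together with [lattice_near], this makes |sin (pi t)| a usable substitute for
    the distance from t to the integers. *)
Lemma sinpi_ge t : `|t| <= 2^-1 -> `|t| <= `|sin (pi * t)|.
Proof.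
have pos_case u : 0 <= u <= 2^-1 -> u <= sin (pi * u).
  move=> /andP[u0 u1]; have p0 := pi_gt0 R; have p2 := pi_ge2 R.
  pose x := pi * u; have x0 : 0 <= x by rewrite mulr_ge0// ltW.
  have x1 : x <= pi / 2 by rewrite /x ler_wpM2l// ltW.
  have x20 : 0 <= x / 2 by lra.
  have [c /andP[c0 c1]] := @mean_value _ sin cos 0 (x / 2) x20 _.
  rewrite sin0 !subr0 => e.
  have cc : cos (x / 2) <= cos c.
    rewrite leNgt ltr_cos ?in_itv/= -?leNgt//; apply/andP; split; lra.
  have cx : 0 <= cos x by apply: cos_ge0_pihalf; apply/andP; split; lra.
  have ch : 0 <= cos (x / 2) by apply: cos_ge0_pihalf; apply/andP; split; lra.
  have h : x / 2 * cos (x / 2) <= sin (x / 2).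
    by rewrite e mulrC ler_wpM2r.
  have s2 : sin x = 2 * (cos (x / 2) * sin (x / 2)).
    rewrite {1}(_ : x = (x / 2) *+ 2); last by rewrite mulr2n; lra.
    by rewrite sin_mulr2n mulr2n; ring.
  have c2 : cos x = 2 * cos (x / 2) ^+ 2 - 1.
    rewrite {1}(_ : x = (x / 2) *+ 2); last by rewrite mulr2n; lra.
    by rewrite cos_mulr2n mulr2n; ring.
  rewrite -/x s2.
  have h3 := ler_wpM2l ch h.
  have h4 : 2^-1 <= cos (x / 2) ^+ 2 by lra.
  have h5 := ler_wpM2l x20 h4.
  have h6 : 2 * u <= x by rewrite /x ler_wpM2r.
  rewrite expr2 in h5; lra.
move=> tb; have [t0|t0] := leP 0 t.
  rewrite ger0_norm// in tb *; apply: le_trans (ler_norm _).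
  by apply: pos_case; rewrite t0.
rewrite ltr0_norm// in tb *; rewrite -normrN -sinN -mulrN.
by apply: le_trans (ler_norm _); apply: pos_case; rewrite oppr_ge0 ltW.
Qed.

End Trig.

Section Separable.
Variables (R : realType) (n : nat).
Local Notation V := 'rV[R]_n.
Variables (g g' : 'I_n -> R -> R).
Hypothesis g_deriv : forall j (t : R), is_derive t 1 (g j) (g' j t).
Hypothesis g'_cont : forall j, continuous (g' j).
Hypothesis g_per : forall j (t : R), g j (t + 1) = g j t.

(** Sums of periodic functions of one coordinate are the only viscosity test
    functions that are used: their periodicity and smoothness are one-dimensional
    questions. *)
Definition separable (y : V) : R := \sum_j g j (y 0 j).

Lemma separable_periodic : lattice_periodic separable.
Proof.
move=> y y' /forallP h; apply: eq_bigr => j _.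
have /intrP[k hk] := h j.
by rewrite -(subrK (y' 0 j) (y 0 j)) hk addrC (int_periodic (g_per j)).
Qed.

Lemma derive_approx j (t : R) (eps : R) : 0 < eps -> exists2 d : R, 0 < d &
  forall h, `|h| < d -> `|g j (h + t) - g j t - h * g' j t| <= eps * `|h|.
Proof.
move=> eps0; have [dg vg] := g_deriv j t.
have df : differentiable (g j) t by exact/derivable1_diffP.
have [d d0 H] := approx_diff df eps0; exists d => // h hd.
have := H h hd; rewrite -[in 'd _ _ h](mulr1 h) [h * 1]/(h *: (1 : R)) linearZ.
by rewrite -deriveE// vg.
Qed.

Lemma separable_grad y : differentiable separable y /\
  grad separable y = \row_j g' j (y 0 j).
Proof.
apply: diff_gradP => eps eps0.
have n1 : 0 < n%:R + 1 :> R by rewrite ltr_wpDl.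
have e0 : 0 < eps / (n%:R + 1) by rewrite divr_gt0.
have /choice[d hd] : forall j, exists d : R, 0 < d /\
    forall h, `|h| < d -> `|g j (h + y 0 j) - g j (y 0 j) - h * g' j (y 0 j)|
      <= eps / (n%:R + 1) * `|h|.
  by move=> j; have [d d0 hd] := derive_approx j (y 0 j) e0; exists d.
exists (\big[Num.min/1]_j d j).
  by apply/bigmin_gtP; split => // j _; have [] := hd j.
move=> h hlt; rewrite /separable /dotp -!sumrB.
apply: le_trans (ler_norm_sum _ _ _) _.
apply: (@le_trans _ _ (\sum_(j < n) eps / (n%:R + 1) * `|h|)).
  apply: ler_sum => j _; rewrite !mxE [g' _ _ * _]mulrC.
  have hj : `|h 0 j| < d j.
    apply: le_lt_trans (coord_norm_le h j) _; apply: lt_le_trans hlt _.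
    exact: bigmin_le.
  apply: le_trans ((hd j).2 _ hj) _.
  by rewrite ler_wpM2l// ?coord_norm_le// ltW.
rewrite sumr_const card_ord -[leLHS]mulr_natl mulrA ler_wpM2r//.
by rewrite mulrCA ler_piMr ?ltW// ltr_pdivrMr// mul1r ltrDl.
Qed.

Lemma separable_grad_continuous : continuous (grad separable).
Proof.
rewrite (_ : grad separable = fun y => \row_j g' j (y 0 j)); last first.
  by apply/funext => y; have [] := separable_grad y.
apply: rV_continuous => j.
rewrite (_ : (fun _ => _) = fun x : V => g' j (x 0 j)); last first.
  by apply/funext => x; rewrite mxE.
move=> x; apply: (@continuous_comp _ _ _ (fun x : V => x 0 j) (g' j)).
  exact: coord_continuous.
exact: g'_cont.
Qed.

End Separable.

(** * Viscosity subsolutions *)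

Lemma pair_continuous (T A B : topologicalType) (f : T -> A) (g : T -> B) (x : T) :
  {for x, continuous f} -> {for x, continuous g} ->
  {for x, continuous (fun t => (f t, g t))}.
Proof.
move=> cf cg.
exact: (@cvg_pair _ _ _ (nbhs x) (nbhs (f x)) (nbhs (g x)) _ _ _ f g cf cg).
Qed.

Lemma enorm_ge_coord (R : realType) n (p : 'rV[R]_n) j : `|p 0 j| <= enorm p.
Proof.
rewrite /enorm -sqrtr_sqr ler_sqrt; last first.
  by apply: sumr_ge0 => i _; apply: sumr_ge0 => k _; exact: sqr_ge0.
rewrite big_ord1 (bigD1 j)//= lerDl.
by apply: sumr_ge0 => k _; exact: sqr_ge0.
Qed.

Lemma enorm_le_sum (R : realType) n (p : 'rV[R]_n) : enorm p <= \sum_j `|p 0 j|.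
Proof.
have s0 : 0 <= \sum_j `|p 0 j| by apply: sumr_ge0.
rewrite /enorm -[leRHS]ger0_norm// -sqrtr_sqr ler_sqrt ?sqr_ge0//.
rewrite big_ord1 expr2 mulr_suml; apply: ler_sum => j _.
rewrite -real_normK ?num_real// expr2 ler_wpM2l// (bigD1 j)//= lerDl.
by apply: sumr_ge0.
Qed.

Lemma enorm_ge0 (R : realType) p q (A : 'M[R]_(p, q)) : 0 <= enorm A.
Proof. exact: sqrtr_ge0. Qed.

Section Subsolution.
Variables (R : realType) (n m : nat) (H : hamiltonian R n m).
Local Notation V := 'rV[R]_n.
Local Notation U := 'rV[R]_m.
Local Notation e j := (delta_mx 0 j : V).
Local Notation pit := (\pi_(torus R n) : V -> torus R n).
Variables (lam : R) (v : torus R n -> U).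
Hypothesis lam_gt0 : 0 < lam.
Hypothesis v_sub : visc_subsolution H lam v.
Hypothesis H_cont : ham_continuous H.
Hypothesis H_coer : ham_coercive H.
Implicit Types (y z p : V) (i : 'I_m) (j : 'I_n) (eps A : R).

(** The inequality that a subsolution satisfies when touched from above at y by
    a function with gradient p. *)
Definition lifted_sub i y p : Prop :=
  lam * tlift v y 0 i + H i (pit y) p (tlift v y) <= 0.

Lemma lift_continuous : continuous (tlift v).
Proof. by apply: tlift_continuous; case: v_sub. Qed.

Lemma lift_comp_continuous i : continuous (fun y => tlift v y 0 i).
Proof.
move=> y; apply: (@continuous_comp _ _ _ (tlift v) (fun u : U => u 0 i)).
  exact: lift_continuous.
exact: coord_continuous.
Qed.

Lemma touching_above i (phi : V -> R) y : lattice_periodic phi ->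
  (forall y, differentiable phi y) -> continuous (grad phi) ->
  (forall y', tlift v y' 0 i - phi y' <= tlift v y 0 i - phi y) ->
  lifted_sub i y (grad phi y).
Proof.
move=> pphi dphi cphi ymax; have [C1 gE] := tC1_descend pphi dphi cphi.
have [_ sub] := v_sub; rewrite /lifted_sub -gE.
apply: sub => // x.
have := ymax (repr x); rewrite /tlift pi_surj.
by rewrite -(pphi _ _ (pi_repr y)).
Qed.

Lemma max_near i (phi : V -> R) z : lattice_periodic phi -> continuous phi ->
  exists y, (forall j, `|y 0 j - z 0 j| <= 2^-1) /\
    forall y', tlift v y' 0 i - phi y' <= tlift v y 0 i - phi y.
Proof.
move=> pphi cphi.
have pf : lattice_periodic (fun y => tlift v y 0 i - phi y).
  by move=> y y' yy'; rewrite (tlift_periodic v yy') (pphi _ _ yy').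
have [|y ymax] := periodic_max pf.
  by move=> y; apply: continuousB; [exact: lift_comp_continuous|exact: cphi].
have [y' [yy' near]] := lattice_near z y.
by exists y'; split => // y2; rewrite [leRHS](pf _ _ yy').
Qed.

Lemma lift_bounded : exists2 M : R, 0 <= M & forall i y, `|tlift v y 0 i| <= M.
Proof.
have [||y ymax] := @periodic_max R n (fun y => `|tlift v y|).
- by move=> y y' yy'; rewrite (tlift_periodic v yy').
- move=> y; apply: (@continuous_comp _ _ _ (tlift v) (fun u : U => `|u|)).
    exact: lift_continuous.
  exact: norm_continuous.
by exists `|tlift v y| => // i y'; apply: le_trans (coord_norm_le _ _) (ymax y').
Qed.

(** Where v is touched from above, H_i(y, p, v) <= lam |v| stays bounded, and
    coercivity bounds p. *)
Lemma grad_bounded : exists2 N : R, 0 < N &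
  forall i y p, lifted_sub i y p -> forall j, `|p 0 j| < N.
Proof.
have [M M0 vM] := lift_bounded.
have r0 : 0 < m%:R * M + 1 by rewrite ltr_wpDl// mulr_ge0.
have /choice[N hN] : forall i, exists N : R, forall p, N <= enorm p ->
    forall x u, enorm u < m%:R * M + 1 -> lam * M + 1 <= H i x p u.
  move=> i; have [N hN] := H_coer i r0 (lam * M + 1).
  exists N => p /hN h x u ur; rewrite -lee_fin; apply: le_trans h _.
  by apply: ereal_inf_lbound; exists (x, u).
exists (\sum_i `|N i| + 1); first by rewrite ltr_wpDl// sumr_ge0.
move=> i y p; rewrite /lifted_sub => sub j; rewrite ltNge; apply/negP => pN.
have Np : N i <= enorm p.
  apply: le_trans (enorm_ge_coord p j); apply: le_trans pN.
  apply: le_trans (ler_norm _) _; rewrite (bigD1 i)//= -addrA lerDl addr_ge0//.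
  exact: sumr_ge0.
have := hN i p Np (pit y) (tlift v y).
have -> : enorm (tlift v y) < m%:R * M + 1.
  apply: le_lt_trans (enorm_le_sum _) _.
  apply: (@le_lt_trans _ _ (\sum_(j < m) M)); first by apply: ler_sum.
  by rewrite sumr_const card_ord -[ltLHS]mulr_natl ltrDl.
move=> /(_ erefl) h; have /ler_normlP[h1 h2] := vM i y.
have := ler_wpM2l (ltW lam_gt0) h1; lra.
Qed.

Lemma ham_lift_continuous i :
  continuous (fun q : V * V => H i (pit q.1) q.2 (tlift v q.1)).
Proof.
move=> q; apply: (@continuous_comp _ _ _
   (fun q : V * V => (pit q.1, (q.2, tlift v q.1)))
   (fun y : torus R n * (V * U) => H i y.1 y.2.1 y.2.2)); last exact: H_cont.
apply: pair_continuous.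
  apply: (@continuous_comp _ _ _ (fun q : V * V => q.1) pit); first exact: cvg_fst.
  exact: pi_torus_continuous.
apply: pair_continuous; first exact: cvg_snd.
apply: (@continuous_comp _ _ _ (fun q : V * V => q.1) (tlift v)); first exact: cvg_fst.
exact: lift_continuous.
Qed.

End Subsolution.

Lemma rV_norm_sqr_le (R : realType) n (t : 'rV[R]_n) (c : R) : 0 <= c ->
  (forall j, t 0 j ^+ 2 <= c) -> `|t| ^+ 2 <= c.
Proof.
move=> c0 h; rewrite -[leRHS]sqr_sqrtr// lerXn2r ?nnegrE ?sqrtr_ge0//.
apply: rV_norm_le => [|j]; first exact: sqrtr_ge0.
by rewrite -sqrtr_sqr ler_sqrt.
Qed.

Section AtDifferentiabilityPoints.
Variables (R : realType) (n m : nat) (H : hamiltonian R n m).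
Local Notation V := 'rV[R]_n.
Local Notation U := 'rV[R]_m.
Local Notation pit := (\pi_(torus R n) : V -> torus R n).
Variables (lam : R) (v : torus R n -> U).
Hypothesis lam_gt0 : 0 < lam.
Hypothesis v_sub : visc_subsolution H lam v.
Hypothesis H_cont : ham_continuous H.
Implicit Types (y z p : V) (i : 'I_m) (j : 'I_n) (eps A t : R).

Section Test.
Variables (z p : V).

(** A periodic function that is linear with slope p to first order at z. *)
Definition slope_test j t : R := p 0 j * ((2 * pi)^-1 * sin (2 * pi * (t - z 0 j))).
Definition slope_test' j t : R := p 0 j * cos (2 * pi * (t - z 0 j)).

Lemma slope_test_deriv j t : is_derive t 1 (slope_test j) (slope_test' j t).
Proof.
have h : is_derive t 1 (fun t : R => sin (2 * pi * (t - z 0 j)))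
    (cos (2 * pi * (t - z 0 j)) * (2 * pi)).
  apply: (@is_derive1_comp _ sin (fun t : R => 2 * pi * (t - z 0 j))).
  exact: is_derive_affine.
have h2 := @is_deriveZ _ _ _ _ (p 0 j * (2 * pi)^-1) t 1 _ h.
rewrite [X in is_derive _ _ X _](_ : _ =
  (p 0 j * (2 * pi)^-1) *: (fun t : R => sin (2 * pi * (t - z 0 j)))); last first.
  by apply/funext => u; rewrite /slope_test mulrA.
move: h2; rewrite [X in is_derive _ _ _ X -> _](_ : _ = slope_test' j t)//.
have cancel (P c q : R) : P != 0 -> q * (2 * P)^-1 * (c * (2 * P)) = q * c.
  by move=> P0; field.
by rewrite /GRing.scale/= /slope_test' cancel// gt_eqF// pi_gt0.
Qed.

Lemma slope_test'_cont j : continuous (slope_test' j).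
Proof.
by move=> t; apply: continuousM; [exact: cst_continuous|exact: cospi_continuous].
Qed.

Lemma slope_test_per j t : slope_test j (t + 1) = slope_test j t.
Proof.
rewrite /slope_test; congr (_ * (_ * _)).
rewrite (_ : 2 * pi * (t + 1 - z 0 j) = 2 * pi * (t - z 0 j) + pi *+ 2); last first.
  by rewrite mulr2n; ring.
exact: sinD2pi.
Qed.

Variable A : R.
Definition touch_test j t : R := slope_test j t + A * sinpi (z 0 j) t ^+ 2.
Definition touch_test' j t : R := slope_test' j t +
  A * (2 * sinpi (z 0 j) t * (pi * cospi (z 0 j) t)).

Lemma touch_test_deriv j t : is_derive t 1 (touch_test j) (touch_test' j t).
Proof.
have h1 := slope_test_deriv j t.
have h2 := @is_deriveZ _ _ _ _ A t 1 _ (is_derive_sinpi2 (z 0 j) t).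
exact: is_deriveD.
Qed.

Lemma touch_test'_cont j : continuous (touch_test' j).
Proof.
move=> t; apply: continuousD; first exact: slope_test'_cont.
apply: continuousM; first exact: cst_continuous.
apply: continuousM.
  by apply: continuousM; [exact: cst_continuous|exact: sinpi_continuous].
by apply: continuousM; [exact: cst_continuous|exact: cospi_continuous].
Qed.

Lemma touch_test_per j t : touch_test j (t + 1) = touch_test j t.
Proof. by rewrite /touch_test slope_test_per sinpi_sqr_periodic. Qed.

End Test.

(** Let p be the gradient of f = v_i at z.  The test function
    psi + A sum_j sin^2 (pi (y_j - z_j)), with psi periodic of gradient p at z,
    touches f from above at some y close to z.  Comparing with z gives
    A |y - z|^2 <= (f - psi)(y) - (f - psi)(z) = o(|y - z|), so A |y - z| is small: the
    penalty hardly changes the gradient at y, which is thus close to p.  The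
    inequality at y passes to z by continuity. *)
Lemma subsolution_at_differentiability i z : let f := fun y => tlift v y 0 i in
  differentiable f z -> lifted_sub H lam v i z (grad f z).
Proof.
move=> f df; rewrite /lifted_sub leNgt; apply/negP => G0.
set p := grad f z in G0 *.
pose G (q : V * V) := lam * f q.1 + H i (pit q.1) q.2 (tlift v q.1).
have cG : {for (z, p), continuous G}.
  apply: (@continuousD _ _ _ (fun q => lam * f q.1)
    (fun q => H i (pit q.1) q.2 (tlift v q.1))); last first.
    exact: (ham_lift_continuous v_sub H_cont).
  apply: continuousM; first exact: cst_continuous.
  apply: (@continuous_comp _ _ _ (fun q : V * V => q.1) f); first exact: cvg_fst.
  exact: (lift_comp_continuous v_sub).
have /continuous_at_normP /(_ _ G0)[d d0 hG] := cG.
have pi0 := pi_gt0 R; have pi2 := pi_ge2 R.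
(* the slope of the penalty is at most 2 pi^2 A |y - z| <= 4 pi^2 eps = d / 8 *)
pose eps := d / (32 * pi ^+ 2).
have pp0 : 0 < 32 * (pi : R) ^+ 2 by rewrite mulr_gt0// exprn_gt0.
have eps0 : 0 < eps by rewrite divr_gt0.
have [d1 d10 h1] := grad_approx df eps0.
pose psi := separable (slope_test z p).
have [dpsi gpsi] := @separable_grad _ _ _ _ (slope_test_deriv z p) z.
have gpsiE : grad psi z = p.
  by rewrite gpsi; apply/rowP => j; rewrite mxE /slope_test' subrr mulr0 cos0 mulr1.
have [d2 d20 h2] := grad_approx dpsi eps0.
have [M2 hM2] : exists M2 : R, forall y, `|f y - psi y| <= M2.
  have [||y0 ymax] := @periodic_max R n (fun y => `|f y - psi y|).
  - move=> y y' yy'; rewrite /f (tlift_periodic v yy').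
    by rewrite /psi (separable_periodic (slope_test_per z p) yy').
  - move=> y.
    apply: (@continuous_comp _ _ _ (fun y => f y - psi y) (fun x : R => `|x|)).
      apply: continuousB; first exact: (lift_comp_continuous v_sub).
      apply: differentiable_continuous.
      by have [] := @separable_grad _ _ _ _ (slope_test_deriv z p) y.
    exact: norm_continuous.
  by exists `|f y0 - psi y0|.
have M20 : 0 <= M2 := le_trans (normr_ge0 _) (hM2 z).
have np0 : 0 < 16 * pi * (`|p| + 1).
  by rewrite mulr_gt0// ?mulr_gt0// ltr_wpDl.
pose d3 := Num.min (Num.min d1 d2) (Num.min d (d / (16 * pi * (`|p| + 1)))).
have d30 : 0 < d3 by rewrite !lt_min d10 d20 d0 divr_gt0.
(* A d3^2 exceeds the oscillation of f - psi, so the contact point is in the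
   ball of radius d3 *)
pose A := (2 * M2 + 1) / d3 ^+ 2.
have A0 : 0 < A by rewrite divr_gt0 ?exprn_gt0// ltr_wpDl// mulr_ge0.
pose phi := separable (touch_test z p A).
have sphi := @separable_grad _ _ _ _ (touch_test_deriv z p A).
have pphi : lattice_periodic phi := separable_periodic (touch_test_per z p A).
have dphi y : differentiable phi y by have [] := sphi y.
have cphi : continuous phi by move=> y; exact: differentiable_continuous.
have [y [yz ymax]] := max_near v_sub i z pphi cphi.
have sub := touching_above v_sub pphi dphi
   (separable_grad_continuous (touch_test_deriv z p A) (@touch_test'_cont z p A)) ymax.
have [_ gphi] := sphi y; rewrite gphi in sub.
set q := \row_j _ in sub.
have phiE y' : phi y' = psi y' + A * \sum_j sinpi (z 0 j) (y' 0 j) ^+ 2.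
  by rewrite /phi /psi /separable mulr_sumr -big_split.
have psiz : psi z = 0.
  by rewrite /psi /separable big1// => j _; rewrite /slope_test subrr mulr0 sin0 !mulr0.
have phiz : phi z = 0.
  rewrite phiE psiz add0r big1 ?mulr0// => j _.
  by rewrite /sinpi subrr mulr0 sin0 expr0n.
have key : A * \sum_j sinpi (z 0 j) (y 0 j) ^+ 2 <= (f y - psi y) - (f z - psi z).
  by have := ymax z; rewrite phiz phiE psiz -/(f z) -/(f y); lra.
have tS j : (y - z) 0 j ^+ 2 <= \sum_j sinpi (z 0 j) (y 0 j) ^+ 2.
  apply: (@le_trans _ _ (sinpi (z 0 j) (y 0 j) ^+ 2)); last first.
    by rewrite (bigD1 j)//= lerDl; apply: sumr_ge0 => k _; exact: sqr_ge0.
  rewrite -[leLHS]real_normK ?num_real// -[leRHS]real_normK ?num_real//.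
  rewrite lerXn2r ?nnegrE// !mxE; exact/sinpi_ge/yz.
have S0 : 0 <= \sum_j sinpi (z 0 j) (y 0 j) ^+ 2.
  by apply: sumr_ge0 => k _; exact: sqr_ge0.
have tS' := rV_norm_sqr_le S0 tS.
have At2 : A * `|y - z| ^+ 2 <= (f y - psi y) - (f z - psi z).
  by apply: le_trans key; rewrite ler_wpM2l// ltW.
have td3 : `|y - z| < d3.
  rewrite -(@ltr_pXn2r _ 2)// ?nnegrE//; last exact: ltW.
  rewrite -(ltr_pM2l A0); apply: (le_lt_trans At2).
  rewrite /A divfK ?gt_eqF ?exprn_gt0//.
  have := hM2 y; have := hM2 z; rewrite !ler_norml => /andP[? ?] /andP[? ?]; lra.
move: (td3); rewrite !lt_min => /andP[/andP[td1 td2] /andP[td td4]].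
have At : A * `|y - z| <= 2 * eps.
  have [->|t0] := eqVneq `|y - z| 0; first by rewrite mulr0 mulr_ge0// ltW.
  have t1 : 0 < `|y - z| by rewrite lt_neqAle eq_sym t0/=.
  rewrite -(ler_pM2r t1) -mulrA -expr2; apply: le_trans At2 _.
  have := h1 _ td1; have := h2 _ td2; rewrite subrK -/psi gpsiE -/p.
  rewrite !ler_norml => /andP[? ?] /andP[? ?]; lra.
have qp j : `|q 0 j - p 0 j| <= d / 2.
  rewrite /q mxE /touch_test' /slope_test'.
  have tj : `|y 0 j - z 0 j| <= `|y - z|.
    by have := coord_norm_le (y - z) j; rewrite !mxE.
  have b1 : `|p 0 j * cos (2 * pi * (y 0 j - z 0 j)) - p 0 j| <= d / 8.
    rewrite -{2}[p 0 j]mulr1 -mulrBr normrM.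
    apply: (@le_trans _ _ ((`|p| + 1) * (2 * pi * `|y - z|))).
      apply: ler_pM => //; first by rewrite ler_wpDr// coord_norm_le.
      have pi20 : 0 <= 2 * pi :> R by rewrite mulr_ge0// ltW.
      by apply: le_trans (cos_near1 _) _; rewrite normrM (ger0_norm pi20) ler_wpM2l.
    by move: td4; rewrite ltr_pdivlMr// => /ltW; lra.
  have b2 : `|A * (2 * sinpi (z 0 j) (y 0 j) * (pi * cospi (z 0 j) (y 0 j)))| <= d / 8.
    rewrite normrM (gtr0_norm A0) 2!normrM ger0_norm// normrM (gtr0_norm pi0).
    have s1 : `|sinpi (z 0 j) (y 0 j)| <= pi * `|y - z|.
      apply: le_trans (sin_le_id _) _; rewrite normrM (gtr0_norm pi0).
      by rewrite ler_wpM2l// ltW.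
    have c1 : pi * `|cospi (z 0 j) (y 0 j)| <= pi.
      by rewrite ler_piMr ?cos_max// ltW.
    apply: (@le_trans _ _ (A * (2 * (pi * `|y - z|) * pi))).
      apply: ler_wpM2l; first exact: ltW.
      apply: ler_pM; last exact: c1.
      - by rewrite mulr_ge0.
      - by rewrite mulr_ge0// ltW.
      - by rewrite ler_wpM2l.
    have -> : A * (2 * (pi * `|y - z|) * pi) = (2 * pi ^+ 2) * (A * `|y - z|) by ring.
    apply: (@le_trans _ _ ((2 * pi ^+ 2) * (2 * eps))).
      by rewrite ler_wpM2l// mulr_ge0// sqr_ge0.
    rewrite le_eqVlt; apply/orP; left; apply/eqP.
    have cancel (P : R) : P != 0 -> 2 * P ^+ 2 * (2 * (d / (32 * P ^+ 2))) = d / 8.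
      by move=> P0; field.
    by rewrite /eps cancel// gt_eqF.
  move: b1 b2; rewrite !ler_norml => /andP[? ?] /andP[? ?].
  by apply/andP; split; lra.
have GE a b : G (a, b) = lam * f a + H i (pit a) b (tlift v a) by [].
have := hG (y, q) _.
suff dd : `|(z, p) - (y, q)| < d.
  move=> /(_ dd); rewrite !GE ltr_norml => /andP[_].
  by rewrite /lifted_sub -/(f y) in sub; rewrite -/(f z) in G0 *; lra.
rewrite [ltLHS]/Num.norm/= gt_max distrC td/=.
apply: (@le_lt_trans _ _ (d / 2)); last by lra.
by apply: rV_norm_le => [|j]; [lra|rewrite !mxE distrC; have := qp j; rewrite !mxE].
Qed.

End AtDifferentiabilityPoints.

Section Lipschitz.
Variables (R : realType) (n m : nat) (H : hamiltonian R n m).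
Local Notation V := 'rV[R]_n.
Local Notation U := 'rV[R]_m.
Local Notation pit := (\pi_(torus R n) : V -> torus R n).
Variables (lam : R) (v : torus R n -> U).
Hypothesis lam_gt0 : 0 < lam.
Hypothesis v_sub : visc_subsolution H lam v.
Hypothesis H_coer : ham_coercive H.
Implicit Types (y z p : V) (i : 'I_m) (j : 'I_n) (eps A t : R).

Section Test.
Variables (a : V) (B delta : R).
Hypothesis delta0 : 0 < delta.

(** A smooth version of |sin (pi (t - a_j))|, whose sum over j behaves like a
    distance to a on the torus. *)
Definition smooth_abs j t : R := Num.sqrt (sinpi (a 0 j) t ^+ 2 + delta ^+ 2).
Definition cone_test j t : R := B * smooth_abs j t.
Definition cone_test' j t : R :=
  B * ((2 * smooth_abs j t)^-1 *
    (2 * sinpi (a 0 j) t * (pi * cospi (a 0 j) t))).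

Lemma smooth_abs_arg_gt0 j t : 0 < sinpi (a 0 j) t ^+ 2 + delta ^+ 2.
Proof. by rewrite ltr_wpDl ?sqr_ge0// exprn_gt0. Qed.

Lemma smooth_abs_gt0 j t : 0 < smooth_abs j t.
Proof. by rewrite sqrtr_gt0 smooth_abs_arg_gt0. Qed.

Lemma smooth_abs_sqr j t : smooth_abs j t ^+ 2 = sinpi (a 0 j) t ^+ 2 + delta ^+ 2.
Proof. by rewrite sqr_sqrtr// ltW// smooth_abs_arg_gt0. Qed.

Lemma smooth_abs_ge j t : `|sinpi (a 0 j) t| <= smooth_abs j t.
Proof.
rewrite -sqrtr_sqr ler_sqrt; first by rewrite lerDl sqr_ge0.
exact/ltW/smooth_abs_arg_gt0.
Qed.

Lemma smooth_abs_ge_delta j t : delta <= smooth_abs j t.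
Proof.
rewrite -[X in X <= _](gtr0_norm delta0) -sqrtr_sqr ler_sqrt.
  by rewrite lerDr sqr_ge0.
exact/ltW/smooth_abs_arg_gt0.
Qed.

Lemma smooth_abs_le j t : smooth_abs j t <= `|sinpi (a 0 j) t| + delta.
Proof.
have h0 : 0 <= `|sinpi (a 0 j) t| + delta by rewrite addr_ge0// ltW.
rewrite -[leRHS]ger0_norm// -sqrtr_sqr ler_sqrt ?sqr_ge0//.
rewrite sqrrD real_normK ?num_real// lerD2r lerDl.
by rewrite mulrn_wge0// mulr_ge0// ltW.
Qed.

Lemma cone_test_deriv j t : is_derive t 1 (cone_test j) (cone_test' j t).
Proof.
have h0 : is_derive t 1 (fun t : R => sinpi (a 0 j) t ^+ 2 + delta ^+ 2)
    (2 * sinpi (a 0 j) t * (pi * cospi (a 0 j) t)).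
  rewrite -[X in is_derive _ _ _ X]addr0.
  by apply: is_deriveD; exact: is_derive_sinpi2.
have h1 : is_derive t 1 (smooth_abs j) ((2 * smooth_abs j t)^-1 *
    (2 * sinpi (a 0 j) t * (pi * cospi (a 0 j) t))).
  apply: (@is_derive1_comp _ Num.sqrt (fun t : R => sinpi (a 0 j) t ^+ 2 + delta ^+ 2)).
  exact/is_derive1_sqrt/smooth_abs_arg_gt0.
exact: (@is_deriveZ _ _ _ _ B t 1 _ h1).
Qed.

Lemma smooth_abs_cont j : continuous (smooth_abs j).
Proof.
move=> t; apply: (@continuous_comp _ _ _
  (fun t : R => sinpi (a 0 j) t ^+ 2 + delta ^+ 2) Num.sqrt); last exact: sqrt_continuous.
apply: continuousD; last exact: cst_continuous.
have -> : (fun t : R => sinpi (a 0 j) t ^+ 2) =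
    fun t => sinpi (a 0 j) t * sinpi (a 0 j) t.
  by apply/funext => u; rewrite expr2.
by apply: continuousM; exact: sinpi_continuous.
Qed.

Lemma cone_test'_cont j : continuous (cone_test' j).
Proof.
move=> t; apply: (@continuousM R R (fun=> B)
  (fun t : R => (2 * smooth_abs j t)^-1 *
    (2 * sinpi (a 0 j) t * (pi * cospi (a 0 j) t)))); first exact: cst_continuous.
apply: (@continuousM R R (fun t : R => (2 * smooth_abs j t)^-1)
    (fun t : R => 2 * sinpi (a 0 j) t * (pi * cospi (a 0 j) t))).
  have c2 : {for t, continuous (fun t : R => 2 * smooth_abs j t)}.
    apply: (@continuousM R R (fun=> 2) (smooth_abs j)); first exact: cst_continuous.
    exact: smooth_abs_cont.
  apply: (continuousV _ c2).
  by rewrite mulf_neq0// gt_eqF// smooth_abs_gt0.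
apply: continuousM.
  by apply: continuousM; [exact: cst_continuous|exact: sinpi_continuous].
by apply: continuousM; [exact: cst_continuous|exact: cospi_continuous].
Qed.

Lemma cone_test_per j t : cone_test j (t + 1) = cone_test j t.
Proof. by rewrite /cone_test /smooth_abs sinpi_sqr_periodic. Qed.

(** Away from the vertex but before the ridge of the cone the slope is at least B:
    there sin^2 >= delta^2 and cos^2 >= 3/4, and pi^2 (1/2) (3/4) >= 1. *)
Lemma cone_test'_large j t : 0 <= B -> delta < `|sinpi (a 0 j) t| ->
  `|sinpi (a 0 j) t| <= 2^-1 -> B <= `|cone_test' j t|.
Proof.
move=> B0 dS S2.
rewrite /cone_test' normrM (ger0_norm B0) -[leLHS]mulr1 ler_wpM2l//.
set S := sinpi _ _ in dS S2 *; set c := cospi _ _; set q := smooth_abs j t.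
have q0 : 0 < q := smooth_abs_gt0 j t.
rewrite (_ : (2 * q)^-1 * (2 * S * (pi * c)) = (S * (pi * c)) / q); last first.
  have e (P : R) : (2 * q)^-1 * (2 * S * (P * c)) = (S * (P * c)) / q.
    by field; rewrite gt_eqF.
  exact: e.
rewrite normrM normfV (gtr0_norm q0) ler_pdivlMr// mul1r.
rewrite -(@ler_pXn2r _ 2)// ?nnegrE ?(ltW q0)//.
rewrite smooth_abs_sqr -/S real_normK ?num_real// !exprMn.
have -> : c ^+ 2 = 1 - S ^+ 2 by rewrite /c /cospi cos2sin2.
have d0 := ltW delta0.
have h1 : delta ^+ 2 <= S ^+ 2.
  by rewrite -[leRHS]real_normK ?num_real// lerXn2r ?nnegrE// ltW.
have h2 : S ^+ 2 <= 4^-1.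
  rewrite -[leLHS]real_normK ?num_real// (_ : 4^-1 = 2^-1 ^+ 2 :> R).
    by rewrite lerXn2r ?nnegrE.
  by rewrite exprVn -natrX.
have p4 : 4 <= (pi : R) ^+ 2.
  rewrite (_ : 4 = 2 ^+ 2 :> R); last by rewrite -natrX.
  by rewrite lerXn2r ?nnegrE ?pi_ge2// ltW// pi_gt0.
have S0 : 0 <= S ^+ 2 := sqr_ge0 S.
have h3 : 3 <= (pi : R) ^+ 2 * (1 - S ^+ 2).
  apply: (@le_trans _ _ (4 * (1 - S ^+ 2))); first by lra.
  by rewrite ler_wpM2r//; lra.
have := ler_wpM2l S0 h3; lra.
Qed.

End Test.

(** Put a smoothed cone of slope B with vertex a above v_i.  At the contact point the
    gradient cannot be as large as B, by [grad_bounded], so that the contact point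
    is within delta of the vertex.  As delta tends to 0, v_i lies below the cone
    whose tip is v_i(a).  The summand 8 M of B keeps the contact point
    away from the ridge, where the cone is not steep. *)
Lemma sub_lipschitz : exists2 K : R, 0 <= K &
  forall i, lip K (fun y => tlift v y 0 i).
Proof.
have [M M0 hM] := lift_bounded v_sub.
have [N N0 hN] := grad_bounded lam_gt0 v_sub H_coer.
pose B := 8 * M + N.
have B0 : 0 < B by rewrite ltr_wpDl// mulr_ge0.
have BN : N <= B by rewrite lerDr mulr_ge0.
have BM : 8 * M <= B by rewrite lerDl ltW.
suff bound i (a y : V) : tlift v y 0 i <=
    tlift v a 0 i + B * \sum_j `|sin (pi * (y 0 j - a 0 j))|.
  have K0 : 0 <= B * (pi * n%:R).
    apply: mulr_ge0; first exact: ltW.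
    by apply: mulr_ge0 => //; exact: pi_ge0.
  exists (B * (pi * n%:R)) => // i; split => //.
  have half (a y : V) : tlift v y 0 i - tlift v a 0 i <= B * (pi * n%:R) * `|y - a|.
    have := bound i a y; rewrite -lerBlDl => /le_trans; apply.
    rewrite -mulrA (ler_wpM2l (ltW B0))//.
    apply: (@le_trans _ _ (\sum_(j < n) pi * `|y - a|)).
      apply: ler_sum => j _; apply: le_trans (sin_le_id _) _.
      rewrite normrM (gtr0_norm (pi_gt0 R)) (ler_wpM2l (pi_ge0 R))//.
      by have := coord_norm_le (y - a) j; rewrite !mxE.
    by rewrite sumr_const card_ord -[leLHS]mulr_natl mulrCA mulrA.
  move=> y z; rewrite ler_norml half andbT lerNl opprB distrC.
  exact: half.
apply/ler_addgt0Pr => eps eps0.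
have B2 : 0 < B * n%:R + 1 by rewrite ltr_wpDl// mulr_ge0// ltW.
have ca : {for a, continuous (fun y => tlift v y 0 i)} by exact: (lift_comp_continuous v_sub).
have /continuous_at_normP /(_ (eps / 2))[|d d0 hd] := ca.
  by rewrite divr_gt0.
pose delta := Num.min (Num.min 4^-1 (d / 2)) (eps / 2 / (B * n%:R + 1)).
have delta0 : 0 < delta by rewrite !lt_min invr_gt0 ltr0n !divr_gt0.
have [[d4 dd] deps] : (delta <= 4^-1 /\ delta <= d / 2) /\
    delta <= eps / 2 / (B * n%:R + 1).
  by rewrite /delta !ge_min !lexx !orbT.
clearbody delta B.
pose phi := separable (cone_test a B delta).
have sphi := @separable_grad _ _ _ _ (@cone_test_deriv a B delta delta0).
have pphi : lattice_periodic phi := separable_periodic (cone_test_per a B delta).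
have dphi u : differentiable phi u by have [] := sphi u.
have cphi : continuous phi by move=> u; exact: differentiable_continuous.
have [z [za zmax]] := max_near v_sub i a pphi cphi.
have sub := touching_above v_sub pphi dphi
   (separable_grad_continuous (@cone_test_deriv a B delta delta0)
     (@cone_test'_cont a B delta delta0)) zmax.
have [_ gphi] := sphi z; rewrite gphi in sub.
have phia : phi a = \sum_(j < n) B * delta.
  apply: eq_bigr => j _; rewrite /cone_test /smooth_abs /sinpi subrr mulr0 sin0.
  by rewrite expr0n add0r sqrtr_sqr gtr0_norm.
have phi_ge (u : V) j : B * (`|sinpi (a 0 j) (u 0 j)| - delta) <= phi u - phi a.
  rewrite phia /phi /separable -sumrB (bigD1 j)//= -[leLHS]addr0; apply: lerD.
    by rewrite /cone_test -mulrBr (ler_wpM2l (ltW B0))// lerD2r smooth_abs_ge.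
  apply: sumr_ge0 => k _; rewrite /cone_test -mulrBr; apply: mulr_ge0; first exact: ltW.
  by rewrite subr_ge0 smooth_abs_ge_delta.
have Sle j : `|sinpi (a 0 j) (z 0 j)| <= delta.
  rewrite leNgt; apply/negP => dS.
  have S2 : `|sinpi (a 0 j) (z 0 j)| <= 2^-1.
    have h1 := phi_ge z j; have h2 := zmax a.
    have /ler_normlP[? ?] := hM i z; have /ler_normlP[? ?] := hM i a.
    have h3 : B * (`|sinpi (a 0 j) (z 0 j)| - delta) <= B * 4^-1 by lra.
    by rewrite ler_pM2l// in h3; lra.
  have := hN i z _ sub j; rewrite mxE ltNge => /negP; apply.
  by apply: le_trans BN _; apply: cone_test'_large => //; exact: ltW.
have az : `|a - z| < d.
  apply: (@le_lt_trans _ _ (d / 2)); last by lra.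
  rewrite distrC; apply: rV_norm_le => [|j]; first by lra.
  rewrite !mxE; apply: le_trans dd; apply: le_trans (Sle j).
  by rewrite /sinpi; apply: sinpi_ge; exact: za.
have := hd z az; rewrite distrC ltr_norml => /andP[_ hz].
have := zmax y.
have phiz : 0 <= phi z.
  by apply: sumr_ge0 => j _; apply/ltW/mulr_gt0 => //; exact: smooth_abs_gt0.
have phiy : phi y <= B * \sum_j `|sin (pi * (y 0 j - a 0 j))| + eps / 2.
  apply: (@le_trans _ _ (B * \sum_j `|sin (pi * (y 0 j - a 0 j))| + B * n%:R * delta)).
    rewrite -mulrA -mulrDr /phi /separable -mulr_sumr (ler_wpM2l (ltW B0))//.
    have -> : n%:R * delta = \sum_(j < n) delta by rewrite sumr_const card_ord mulr_natl.
    rewrite -big_split/=.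
    by apply: ler_sum => j _; exact: smooth_abs_le.
  rewrite lerD2l; move: deps; rewrite ler_pdivlMr// mulrDr mulr1 mulrC.
  by apply: le_trans; rewrite lerDl ltW.
lra.
Qed.

End Lipschitz.

(** * Smooth approximate subsolutions *)

Section EuclideanNorm.
Variables (R : realType).
Implicit Types (n m : nat).

Lemma enorm_sqr n (p : 'rV[R]_n) : enorm p ^+ 2 = \sum_j p 0 j ^+ 2.
Proof.
rewrite sqr_sqrtr; first by rewrite big_ord1.
by apply: sumr_ge0 => i _; apply: sumr_ge0 => k _; exact: sqr_ge0.
Qed.

Lemma enorm0_eq0 n (p : 'rV[R]_n) j : enorm p = 0 -> p 0 j = 0.
Proof.
by move=> p0; have := enorm_ge_coord p j; rewrite p0 normr_le0 => /eqP.
Qed.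

(** Cauchy-Schwarz, from the sum of the squares of |q| p_j - |p| q_j. *)
Lemma dotp_le_enorm n (p q : 'rV[R]_n) : dotp p q <= enorm p * enorm q.
Proof.
have [p0|p0] := eqVneq (enorm p) 0.
  by rewrite p0 mul0r /dotp big1// => j _; rewrite (enorm0_eq0 j p0) mul0r.
have [q0|q0] := eqVneq (enorm q) 0.
  by rewrite q0 mulr0 /dotp big1// => j _; rewrite (enorm0_eq0 j q0) mulr0.
have p1 : 0 < enorm p by rewrite lt_neqAle eq_sym p0 enorm_ge0.
have q1 : 0 < enorm q by rewrite lt_neqAle eq_sym q0 enorm_ge0.
set a := enorm p in p0 p1 *; set b := enorm q in q0 q1 *.
have h : 0 <= \sum_j (b * p 0 j - a * q 0 j) ^+ 2.
  by apply: sumr_ge0 => j _; exact: sqr_ge0.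
have e : \sum_j (b * p 0 j - a * q 0 j) ^+ 2
   = b ^+ 2 * (\sum_j p 0 j ^+ 2) + a ^+ 2 * (\sum_j q 0 j ^+ 2) - 2 * a * b * dotp p q.
  rewrite /dotp !mulr_sumr -big_split/= -sumrB; apply: eq_bigr => j _; ring.
rewrite e -!enorm_sqr -/a -/b in h.
have ab : 0 < 2 * a * b by rewrite !mulr_gt0.
by rewrite -(ler_pM2l ab) -subr_ge0; apply: le_trans h _;
  rewrite le_eqVlt; apply/orP; left; apply/eqP; ring.
Qed.

Lemma enormD n (p q : 'rV[R]_n) : enorm (p + q) <= enorm p + enorm q.
Proof.
have h0 : 0 <= enorm p + enorm q by rewrite addr_ge0 ?enorm_ge0.
rewrite -(@ler_pXn2r _ 2)// ?nnegrE ?enorm_ge0// sqrrD !enorm_sqr.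
have -> : \sum_j (p + q) 0 j ^+ 2
   = \sum_j p 0 j ^+ 2 + dotp p q *+ 2 + \sum_j q 0 j ^+ 2.
  rewrite /dotp -sumrMnl -!big_split/=; apply: eq_bigr => j _.
  by rewrite !mxE sqrrD.
rewrite lerD2r lerD2l !mulr2n; have := dotp_le_enorm p q; lra.
Qed.

Lemma enormZ n (c : R) (p : 'rV[R]_n) : 0 <= c -> enorm (c *: p) = c * enorm p.
Proof.
move=> c0; rewrite -[RHS]ger0_norm; last by rewrite mulr_ge0 ?enorm_ge0.
rewrite -sqrtr_sqr exprMn enorm_sqr {1}/enorm big_ord1 mulr_sumr.
by congr Num.sqrt; apply: eq_bigr => j _; rewrite !mxE exprMn.
Qed.

Lemma enorm_continuous n : continuous (@enorm R 1 n).
Proof.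
apply: (@lip_continuous _ _ n%:R); split => // p q.
have h (a b : 'rV[R]_n) : enorm a - enorm b <= n%:R * `|a - b|.
  rewrite lerBlDr -{1}[a](subrK b); apply: le_trans (enormD _ _) _.
  rewrite lerD2r; apply: le_trans (enorm_le_sum _) _.
  apply: (@le_trans _ _ (\sum_(j < n) `|a - b|)).
    by apply: ler_sum => j _; exact: coord_norm_le.
  by rewrite sumr_const card_ord -[leLHS]mulr_natl.
by rewrite ler_norml h andbT lerNl opprB distrC; exact: h.
Qed.

End EuclideanNorm.

Section Approximation.
Variables (R : realType) (n m : nat) (H : hamiltonian R n m).
Local Notation V := 'rV[R]_n.
Local Notation U := 'rV[R]_m.
Local Notation pit := (\pi_(torus R n) : V -> torus R n).
Variables (lam : R) (v : torus R n -> U).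
Hypothesis lam_gt0 : 0 < lam.
Hypothesis v_sub : visc_subsolution H lam v.
Hypothesis H_cont : ham_continuous H.
Hypothesis H_coer : ham_coercive H.
Hypothesis H_conv : ham_convex H.
Implicit Types (y z p : V) (u : U) (i a : 'I_m) (j : 'I_n) (eps A t : R).

Lemma ham_midconvex i x (w w' : V * U) :
  H i x (2^-1 *: (w + w')).1 (2^-1 *: (w + w')).2
  <= 2^-1 * (H i x w.1 w.2 + H i x w'.1 w'.2).
Proof.
have h0 : 0 <= 2^-1 :> R by rewrite invr_ge0.
have h1 : 2^-1 <= 1 :> R by lra.
have := H_conv x i (Itv01 h0 h1) (in_setT w) (in_setT w').
rewrite convRE /conv/= /unstable.onem.
have -> : 1 - 2^-1 = 2^-1 :> R by lra.
by rewrite -!scalerDr.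
Qed.

Lemma ham_jet_continuous i x : continuous (fun w : V * U => H i x w.1 w.2).
Proof.
move=> w; apply: (@continuous_comp _ _ _
   (fun w : V * U => (x, w)) (fun y : torus R n * (V * U) => H i y.1 y.2.1 y.2.2));
  last exact: H_cont.
by apply: pair_continuous; [exact: cst_continuous|exact: cvg_id].
Qed.

(** A Heine argument on the compact set of all (y, p, u) of norm at most B, the
    increment h playing the role of the parameter that tends to 0. *)
Lemma ham_uniform_in_x i (B eps : R) : 0 < eps -> exists2 r : R, 0 < r &
  forall y h p u, `|y| <= B -> `|h| < r -> `|p| <= B -> `|u| <= B ->
    `|H i (pit (h + y)) p u - H i (pit y) p u| < eps.
Proof.
move=> eps0.
pose K := [set y : V | `|y| <= B] `*` ([set p : V | `|p| <= B] `*` [set u : U | `|u| <= B]).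
have cK : compact K.
  by apply: compact_setX; [|apply: compact_setX]; exact: compact_norm_le.
pose P (h : V) (q : V * (V * U)) :=
  `|H i (pit (h + q.1)) q.2.1 q.2.2 - H i (pit q.1) q.2.1 q.2.2| < eps.
have near_P q : K q -> \forall q' \near q & h \near (0 : V), P h q'.
  move=> _.
  pose G (qh : (V * (V * U)) * V) :=
    H i (pit (qh.2 + qh.1.1)) qh.1.2.1 qh.1.2.2 - H i (pit qh.1.1) qh.1.2.1 qh.1.2.2.
  have cG : {for (q, 0 : V), continuous G}.
    apply: continuousB.
      apply: (@continuous_comp _ _ _
        (fun qh : (V * (V * U)) * V => (pit (qh.2 + qh.1.1), qh.1.2))
        (fun y : torus R n * (V * U) => H i y.1 y.2.1 y.2.2)); last exact: H_cont.
      apply: pair_continuous.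
        apply: (@continuous_comp _ _ _
          (fun qh : (V * (V * U)) * V => qh.2 + qh.1.1) pit).
          apply: continuousD; first exact: cvg_snd.
          apply: (@continuous_comp _ _ _ (fun qh : (V * (V * U)) * V => qh.1)
            (fun q : V * (V * U) => q.1)); [exact: cvg_fst|exact: cvg_fst].
        exact: pi_torus_continuous.
      apply: (@continuous_comp _ _ _ (fun qh : (V * (V * U)) * V => qh.1)
        (fun q : V * (V * U) => q.2)); [exact: cvg_fst|exact: cvg_snd].
    apply: (@continuous_comp _ _ _
      (fun qh : (V * (V * U)) * V => (pit qh.1.1, qh.1.2))
      (fun y : torus R n * (V * U) => H i y.1 y.2.1 y.2.2)); last exact: H_cont.
    apply: pair_continuous.
      apply: (@continuous_comp _ _ _
        (fun qh : (V * (V * U)) * V => qh.1.1) pit).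
        apply: (@continuous_comp _ _ _ (fun qh : (V * (V * U)) * V => qh.1)
          (fun q : V * (V * U) => q.1)); [exact: cvg_fst|exact: cvg_fst].
      exact: pi_torus_continuous.
    apply: (@continuous_comp _ _ _ (fun qh : (V * (V * U)) * V => qh.1)
      (fun q : V * (V * U) => q.2)); [exact: cvg_fst|exact: cvg_snd].
  have G0 : G (q, 0) = 0 by rewrite /G/= add0r subrr.
  have := cG; rewrite /continuous_at => /cvgrPdist_lt /(_ eps eps0).
  apply: filterS => -[q' h] /=.
  by rewrite G0 sub0r normrN.
have N0 : nbhs (0 : V) (fun h => K `<=` P h).
  exact: (compact_near_coveringP K).1 cK _ (nbhs (0 : V)) P _ near_P.
have /nbhs_normP[r /= r0 hr] := N0; exists r => // y h p u yB hB pB uB.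
apply: (hr h _ (y, (p, u))) => //.
by rewrite /ball_/= sub0r normrN.
Qed.

End Approximation.

Section Smoothing.
Variables (R : realType) (n m : nat) (H : hamiltonian R n m).
Local Notation V := 'rV[R]_n.
Local Notation U := 'rV[R]_m.
Local Notation pit := (\pi_(torus R n) : V -> torus R n).
Variables (lam : R) (v : torus R n -> U).
Hypothesis lam_gt0 : 0 < lam.
Hypothesis v_sub : visc_subsolution H lam v.
Hypothesis H_cont : ham_continuous H.
Hypothesis H_coer : ham_coercive H.
Hypothesis H_conv : ham_convex H.
Variable C : R.
Hypothesis v_bound : torus_ae (fun x => tdifferentiable_vec v x /\
                                enorm (v x) + enorm (tjacobian v x) <= C).
Implicit Types (y z p : V) (u : U) (i a : 'I_m) (j : 'I_n) (eps A t : R).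

Lemma norm_le_enorm k (p : 'rV[R]_k) : `|p| <= enorm p.
Proof. by apply: rV_norm_le => [|j]; [exact: enorm_ge0|exact: enorm_ge_coord]. Qed.

Lemma enorm_row_le (A : 'M[R]_(m, n)) (p : V) i : (forall j, p 0 j = A i j) ->
  enorm p <= enorm A.
Proof.
move=> pA; rewrite /enorm ler_sqrt; last first.
  by apply: sumr_ge0 => k _; apply: sumr_ge0 => l _; exact: sqr_ge0.
rewrite big_ord1 (eq_bigr (fun j => A i j ^+ 2)); last by move=> j _; rewrite pA.
rewrite [leRHS](bigD1 i)//= lerDl.
by apply: sumr_ge0 => k _; apply: sumr_ge0 => l _; exact: sqr_ge0.
Qed.

Definition lifted_comp a y := tlift v y 0 a.

(** The exceptional null set of the a.e. hypothesis on v. *)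
Definition bad_points : set V := [set y | ~ (tdifferentiable_vec v (pit y) /\
  enorm (v (pit y)) + enorm (tjacobian v (pit y)) <= C)].

Lemma good_pointP y i : ~ bad_points y ->
  [/\ differentiable (lifted_comp i) y, enorm (grad (lifted_comp i) y) + enorm (tlift v y) <= C
    & lam * tlift v y 0 i + H i (pit y) (grad (lifted_comp i) y) (tlift v y) <= 0].
Proof.
move=> /notP[dv bv].
have pf : lattice_periodic (lifted_comp i).
  by move=> y1 y2 y12; rewrite /lifted_comp (tlift_periodic v y12).
have [df ge] := periodic_diff pf (pi_repr y) (dv i).
split=> //; last exact: (subsolution_at_differentiability v_sub H_cont).
apply: le_trans bv; rewrite addrC lerD2l.
by apply: (@enorm_row_le _ _ i) => j; rewrite ge [RHS]mxE.
Qed.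

Lemma row_lifted_comp y : \row_a lifted_comp a y = tlift v y.
Proof. by apply/rowP => a; rewrite mxE. Qed.

(** The mean psi of v over cubes of small side r.  [mollified_bound] is used with
    F(p, u) = |p| + |u| and c = C, then with F(p, u) = lam u_i + H_i(y, p, u) and
    c = delta.  In the second case x is frozen at the corner y of the cube, which costs
    delta by uniform continuity, for the jets of v at good points are bounded
    by C. *)
Lemma smooth_subsolution (delta : R) : 0 < delta ->
  exists psi : torus R n -> U, [/\ tC1_vec psi,
    forall x i, enorm (tgrad (tcomp psi i) x) + enorm (psi x) <= C,
    forall x i, lam * psi x 0 i + H i x (tgrad (tcomp psi i) x) (psi x) <= delta &
    forall x i, `|psi x 0 i - v x 0 i| <= delta].
Proof.
move=> delta0.
have [K K0 lK] := sub_lipschitz lam_gt0 v_sub H_coer.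
have [M M0 hM] := lift_bounded v_sub.
have bM a y : `|lifted_comp a y| <= M by exact: hM.
have /choice[r0 hr0] : forall i, exists r : R, 0 < r /\
  forall y h p u, `|y| <= `|C| + 1 -> `|h| < r -> `|p| <= `|C| + 1 -> `|u| <= `|C| + 1 ->
    `|H i (pit (h + y)) p u - H i (pit y) p u| < delta.
  by move=> i; have [r ? ?] := ham_uniform_in_x H_cont i (`|C| + 1) delta0; exists r.
pose r1 : R := \big[Num.min/1]_i Num.min (r0 i) (delta / (K + 1)).
have K1 : 0 < K + 1 by rewrite ltr_wpDl.
have r10 : 0 < r1.
  apply/bigmin_gtP; split => // i _.
  by rewrite lt_min; have [-> _] := hr0 i; rewrite divr_gt0// K1.
pose r : R := r1 / 2.
have r_gt0 : 0 < r by rewrite divr_gt0.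
have r_lt i : r < r0 i /\ r < delta / (K + 1).
  have : r1 <= Num.min (r0 i) (delta / (K + 1)) by exact: bigmin_le.
  by rewrite le_min /r => /andP[? ?]; split; lra.
pose s : V := const_mx r.
have s0 : pos_sides s by move=> j; rewrite /s mxE; exact: r_gt0.
have lip_comps a : lipschitz (lifted_comp a) by exists K; exact: lK.
pose g y : U := \row_a bmean s (lifted_comp a) y.
have pg : lattice_periodic g.
  move=> y y' yy'; apply/rowP => a; rewrite !mxE.
  rewrite -(subrK y' y) addrC; apply: bmean_shift => z.
  apply: (congr1 (fun u : U => u 0 a)); apply: tlift_periodic.
  apply/forallP => j; rewrite !mxE addrAC subrr add0r.
  by move/forallP : yy' => /(_ j).
pose psi := fun x : torus R n => g (repr x).
have psiE y : psi (pit y) = g y by apply: pg; exact: pi_repr.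
have compE i : tcomp psi i = fun x => bmean s (lifted_comp i) (repr x).
  by apply/funext => x; rewrite /tcomp mxE.
have pb i : lattice_periodic (bmean s (lifted_comp i)).
  by move=> y y' /pg /rowP /(_ i); rewrite !mxE.
have gradE i y : grad (bmean s (lifted_comp i)) y = bgrad s (lifted_comp i) y.
  by have [] := bmean_grad y s0 (lip_comps i).
have C1 i := @tC1_descend _ _ (bmean s (lifted_comp i)) (pb i)
  (fun y => (bmean_grad y s0 (lip_comps i)).1).
have cgrad i : continuous (grad (bmean s (lifted_comp i))).
  by rewrite (funext (gradE i)); exact: bgrad_continuous.
have tgradE i y : tgrad (tcomp psi i) (pit y) = bgrad s (lifted_comp i) y.
  by rewrite compE (C1 i (cgrad i)).2 gradE.
have rep x : exists2 y, pit y = x & `|y| <= 2^-1.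
  have [y [yx hy]] := lattice_near 0 (repr x).
  exists y; first by rewrite (pi_eq yx) pi_surj.
  by apply: rV_norm_le => // j; have := hy j; rewrite mxE subr0.
have in_cell y z : cell y s z -> `|z - y| <= r.
  move=> yz; apply: rV_norm_le => [|j]; first exact: ltW.
  by have := yz j; rewrite !mxE => /andP[? ?]; rewrite ler_norml; apply/andP; split; lra.
exists psi; split.
- by move=> i; rewrite compE; have [] := C1 i (cgrad i).
- move=> x i; have [y <- _] := rep x; rewrite tgradE psiE.
  pose F (w : V * U) := enorm w.1 + enorm w.2.
  apply: (@mollified_bound _ _ _ lifted_comp i K M lK bM F _ _ bad_points C r y) => //.
  + move=> w; apply: (@continuousD _ _ _ (fun w : V * U => enorm w.1)
      (fun w : V * U => enorm w.2)).
      apply: (@continuous_comp _ _ _ (fun w : V * U => w.1) (@enorm R 1 n)).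
        exact: cvg_fst.
      exact: enorm_continuous.
    apply: (@continuous_comp _ _ _ (fun w : V * U => w.2) (@enorm R 1 m)).
      exact: cvg_snd.
    exact: enorm_continuous.
  + move=> w w'; rewrite /F /= !enormZ ?invr_ge0//.
    by have := enormD w.1 w'.1; have := enormD w.2 w'.2; lra.
  + by move=> z _ /(good_pointP i)[df bf _]; rewrite row_lifted_comp.
- move=> x i; have [y <- y2] := rep x; rewrite tgradE psiE.
  pose F (w : V * U) := lam * w.2 0 i + H i (pit y) w.1 w.2.
  apply: (@mollified_bound _ _ _ lifted_comp i K M lK bM F _ _ bad_points delta r y) => //.
  + move=> w; apply: (@continuousD _ _ _ (fun w : V * U => lam * w.2 0 i)
      (fun w : V * U => H i (pit y) w.1 w.2)); last exact: (ham_jet_continuous H_cont).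
    apply: continuousM; first exact: cst_continuous.
    apply: (@continuous_comp _ _ _ (fun w : V * U => w.2) (fun u : U => u 0 i)).
      exact: cvg_snd.
    exact: coord_continuous.
  + move=> w w'; have := ham_midconvex H_conv i (pit y) w w'.
    by rewrite /F /= !mxE; lra.
  + move=> z yz /(good_pointP i)[df bf sf]; rewrite row_lifted_comp; split => //.
    rewrite /F/=; have [_ h] := hr0 i.
    have Cn := ler_norm C.
    have gn := norm_le_enorm (grad (lifted_comp i) z); have vn := norm_le_enorm (tlift v z).
    have ge := enorm_ge0 (grad (lifted_comp i) z); have ve := enorm_ge0 (tlift v z).
    have := h y (z - y) (grad (lifted_comp i) z) (tlift v z).
    rewrite subrK => hh; apply: (@le_trans _ _ (delta + 0)); last by rewrite addr0.
    suff : `|H i (pit z) (grad (lifted_comp i) z) (tlift v z)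
        - H i (pit y) (grad (lifted_comp i) z) (tlift v z)| < delta.
      by rewrite ltr_norml => /andP[? ?]; clear hh h; lra.
    clear h; apply: hh.
    + by apply: le_trans y2 _; have := normr_ge0 C; lra.
    + by apply: le_lt_trans (in_cell _ _ yz) _; have [] := r_lt i.
    + by lra.
    + by lra.
- move=> x i; have [y <- _] := rep x; rewrite psiE mxE.
  apply: bmean_near => // z yz; have [_ lKi] := lK i.
  apply: le_trans (lKi z y) _.
  apply: (@le_trans _ _ ((K + 1) * r)).
    by apply: ler_pM => //; [rewrite lerDl|exact: in_cell].
  by have [_] := r_lt i; rewrite ltr_pdivlMr ?K1// mulrC => /ltW.
Qed.

End Smoothing.

(** * Measurability and the Fenchel gap *)

Section DotContinuity.
Variables (R : realType) (T : topologicalType) (n : nat).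

Lemma dotp_pair_continuous (f g : T -> 'rV[R]_n) (x : T) :
  {for x, continuous f} -> {for x, continuous g} ->
  {for x, continuous (fun t => dotp (f t) (g t))}.
Proof.
move=> cf cg; rewrite /dotp.
elim: (index_enum _) => [|j l IH].
  rewrite (_ : (fun t => _) = fun=> 0); first exact: cst_continuous.
  by apply/funext => t; rewrite big_nil.
rewrite (_ : (fun t => _) = fun t => f t 0 j * g t 0 j +
    \sum_(j <- l) f t 0 j * g t 0 j); last first.
  by apply/funext => t; rewrite big_cons.
apply: (@continuousD _ _ _ (fun t => f t 0 j * g t 0 j)
   (fun t => \sum_(j <- l) f t 0 j * g t 0 j)); last exact: IH.
apply: (@continuousM _ _ (fun t => f t 0 j) (fun t => g t 0 j)).
  apply: (@continuous_comp _ _ _ f (fun u : 'rV[R]_n => u 0 j)) => //.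
  exact: coord_continuous.
apply: (@continuous_comp _ _ _ g (fun u : 'rV[R]_n => u 0 j)) => //.
exact: coord_continuous.
Qed.

End DotContinuity.

Lemma fst_continuous (T A B : topologicalType) (f : T -> A * B) (x : T) :
  {for x, continuous f} -> {for x, continuous (fun t => (f t).1)}.
Proof.
by move=> cf; apply: (@continuous_comp _ _ _ f (fun q => q.1)) => //; exact: cvg_fst.
Qed.

Lemma snd_continuous (T A B : topologicalType) (f : T -> A * B) (x : T) :
  {for x, continuous f} -> {for x, continuous (fun t => (f t).2)}.
Proof.
by move=> cf; apply: (@continuous_comp _ _ _ f (fun q => q.2)) => //; exact: cvg_snd.
Qed.

Lemma ham_comp_continuous (R : realType) n m (H : hamiltonian R n m) i
    (T : topologicalType) (a : T -> torus R n) (b : T -> 'rV[R]_n)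
    (c : T -> 'rV[R]_m) (x : T) : ham_continuous H ->
  {for x, continuous a} -> {for x, continuous b} -> {for x, continuous c} ->
  {for x, continuous (fun t => H i (a t) (b t) (c t))}.
Proof.
move=> cH ca cb cc.
apply: (@continuous_comp _ _ _ (fun t => (a t, (b t, c t)))
   (fun y : torus R n * ('rV[R]_n * 'rV[R]_m) => H i y.1 y.2.1 y.2.2)); last exact: cH.
by apply: pair_continuous => //; exact: pair_continuous.
Qed.

Section Phase.
Variables (R : realType) (n m : nat) (H : hamiltonian R n m).
Local Notation V := 'rV[R]_n.
Local Notation U := 'rV[R]_m.
Local Notation phase := (torus R n * (V * U))%type.
Local Notation bphase := (borel_phase R n m).
Hypothesis H_cont : ham_continuous H.
Implicit Types (i : 'I_m).

Lemma open_measurable_phase (A : set phase) : open A -> measurable (A : set bphase).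
Proof. by move=> oA; exact: sub_sigma_algebra. Qed.

(** It applies to continuous functions and to L, a supremum of continuous
    functions. *)
Lemma lsc_measurable_phase (f : phase -> \bar R) :
  (forall a : R, open [set y | a%:E < f y]%E) ->
  measurable_fun [set: bphase] (f : bphase -> \bar R).
Proof.
move=> of_ mD; apply: (measurability _ (ErealGenOInfty.measurableE R)) => //.
move=> _ [_ [a ->] <-]; rewrite setTI; apply: open_measurable_phase.
rewrite (_ : _ @^-1` _ = [set y | a%:E < f y]%E); first exact: of_.
by apply/seteqP; split => y /=; rewrite in_itv/= ?andbT.
Qed.

Lemma continuous_measurable_phase (f : phase -> R) : continuous f ->
  measurable_fun [set: bphase] (fun y : bphase => (f y)%:E).
Proof.
move=> cf; apply: lsc_measurable_phase => a.
rewrite (_ : [set y | _] = f @^-1` [set x | a < x]).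
  by apply: open_comp; [move=> y _; exact: cf|exact: open_gt].
by apply/seteqP; split => y /=; rewrite lte_fin.
Qed.

Lemma lagrangian_measurable i :
  measurable_fun [set: bphase] (fun y : bphase => lagrangian H i y.1 y.2.1 y.2.2).
Proof.
apply: (@lsc_measurable_phase (fun y => lagrangian H i y.1 y.2.1 y.2.2)) => a.
rewrite (_ : [set y | _] = \bigcup_(w in [set: V * U])
   ((fun y : phase => dotp y.2.1 w.1 + dotp y.2.2 w.2 - H i y.1 w.1 w.2)
     @^-1` [set x | a < x])).
  apply: bigcup_open => w _; apply: open_comp; last exact: open_gt.
  move=> y _; apply: (@continuousB _ _ _
    (fun y : phase => dotp y.2.1 w.1 + dotp y.2.2 w.2) (fun y : phase => H i y.1 w.1 w.2)).
    apply: (@continuousD _ _ _ (fun y : phase => dotp y.2.1 w.1)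
      (fun y : phase => dotp y.2.2 w.2)).
    + apply: dotp_pair_continuous; last exact: cst_continuous.
      by apply: fst_continuous; exact: cvg_snd.
    + apply: dotp_pair_continuous; last exact: cst_continuous.
      by apply: snd_continuous; exact: cvg_snd.
  apply: (@ham_comp_continuous _ _ _ H i phase (fun y => y.1) (fun=> w.1) (fun=> w.2)).
  + exact: H_cont.
  + exact: cvg_fst.
  + exact: cst_continuous.
  + exact: cst_continuous.
apply/seteqP; split => y /=.
  move=> /ereal_sup_gt[_ [w _ <-]]; rewrite lte_fin => aw; by exists w.
move=> [w _ /= aw]; apply: (@lt_le_trans _ _ (dotp y.2.1 w.1 + dotp y.2.2 w.2 - H i y.1 w.1 w.2)%:E).
  by rewrite lte_fin.
by apply: ereal_sup_ubound; exists w.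
Qed.

Lemma lagrangian_ge i x xi eta p u :
  ((dotp xi p + dotp eta u - H i x p u)%:E <= lagrangian H i x xi eta)%E.
Proof. by apply: ereal_sup_ubound; exists (p, u). Qed.

Variables (C : R).

(** Each (p, u) of the compact set comes with a (q, t) violating the subgradient
    inequality at (x0, w0).  The violation persists for nearby p, u, x, w and with a
    small margin c, and compactness makes the neighbourhood and c uniform. *)
Lemma uniform_gap i (x0 : torus R n) (w0 : V * U) :
  (forall p u, enorm p + enorm u <= C -> ~ subdifferential (H i x0) p u w0) ->
  exists (A : set phase) (c : R), [/\ open A, A (x0, w0), 0 < c &
    forall y p u, A y -> enorm p + enorm u <= C ->
      ((c + dotp y.2.1 p + dotp y.2.2 u - H i y.1 p u)%:E
        <= lagrangian H i y.1 y.2.1 y.2.2)%E].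
Proof.
move=> nsub.
pose K := [set w : V * U | enorm w.1 + enorm w.2 <= C].
have cK : compact K.
  apply: (@subclosed_compact _ _ ([set p : V | `|p| <= C] `*` [set u : U | `|u| <= C])).
  - rewrite (_ : K = (fun w : V * U => enorm w.1 + enorm w.2) @^-1` [set x | x <= C])//.
    apply: closed_comp; last exact: closed_le.
    move=> w _; apply: (@continuousD _ _ _ (fun w : V * U => enorm w.1)
      (fun w : V * U => enorm w.2)).
      apply: (@continuous_comp _ _ _ (fun w : V * U => w.1) (@enorm R 1 n)).
        exact: cvg_fst.
      exact: enorm_continuous.
    apply: (@continuous_comp _ _ _ (fun w : V * U => w.2) (@enorm R 1 m)).
      exact: cvg_snd.
    exact: enorm_continuous.
  - by apply: compact_setX; exact: compact_norm_le.
  - move=> [p u]; rewrite /K /= => pu.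
    have := norm_le_enorm p; have := norm_le_enorm u.
    by have := enorm_ge0 p; have := enorm_ge0 u => *; split => /=; lra.
pose G (qt : V * U) (t : (V * U) * (phase * R)) : R :=
  dotp t.2.1.2.1 (qt.1 - t.1.1) + dotp t.2.1.2.2 (qt.2 - t.1.2)
  + H i t.2.1.1 t.1.1 t.1.2 - H i t.2.1.1 qt.1 qt.2 - t.2.2.
pose P (yc : phase * R) (w : V * U) := exists qt, 0 < G qt (w, yc).
have near_P w : K w -> \forall w' \near w & yc \near ((x0, w0) : phase, 0 : R), P yc w'.
  move=> Kw; have /existsNP[q /existsNP[t0]] := nsub _ _ Kw.
  move=> /negP; rewrite -ltNge => h.
  have G0 : 0 < G (q, t0) (w, ((x0, w0), 0)) by rewrite /G/=; lra.
  have cG : {for (w, ((x0, w0), 0)), continuous (G (q, t0))}.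
    have c21 : {for (w, ((x0, w0), 0)), continuous
        (fun t : (V * U) * (phase * R) => t.2.1)}.
      by apply: fst_continuous; exact: cvg_snd.
    have c11 : {for (w, ((x0, w0), 0)), continuous
        (fun t : (V * U) * (phase * R) => t.1.1)}.
      by apply: fst_continuous; exact: cvg_fst.
    have c12 : {for (w, ((x0, w0), 0)), continuous
        (fun t : (V * U) * (phase * R) => t.1.2)}.
      by apply: snd_continuous; exact: cvg_fst.
    apply: (@continuousB _ _ _ (fun t : (V * U) * (phase * R) =>
        dotp t.2.1.2.1 (q - t.1.1) + dotp t.2.1.2.2 (t0 - t.1.2)
        + H i t.2.1.1 t.1.1 t.1.2 - H i t.2.1.1 q t0) (fun t => t.2.2)); last first.
      by apply: snd_continuous; exact: cvg_snd.
    apply: (@continuousB _ _ _ (fun t : (V * U) * (phase * R) =>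
        dotp t.2.1.2.1 (q - t.1.1) + dotp t.2.1.2.2 (t0 - t.1.2)
        + H i t.2.1.1 t.1.1 t.1.2) (fun t => H i t.2.1.1 q t0)); last first.
      apply: (@ham_comp_continuous _ _ _ H i _
        (fun t : (V * U) * (phase * R) => t.2.1.1) (fun=> q) (fun=> t0)).
      + exact: H_cont.
      + exact: (fst_continuous c21).
      + exact: cst_continuous.
      + exact: cst_continuous.
    apply: (@continuousD _ _ _ (fun t : (V * U) * (phase * R) =>
        dotp t.2.1.2.1 (q - t.1.1) + dotp t.2.1.2.2 (t0 - t.1.2))
        (fun t => H i t.2.1.1 t.1.1 t.1.2)); last first.
      apply: (@ham_comp_continuous _ _ _ H i _
        (fun t : (V * U) * (phase * R) => t.2.1.1) (fun t => t.1.1) (fun t => t.1.2)).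
      + exact: H_cont.
      + exact: (fst_continuous c21).
      + exact: c11.
      + exact: c12.
    apply: (@continuousD _ _ _ (fun t : (V * U) * (phase * R) =>
        dotp t.2.1.2.1 (q - t.1.1)) (fun t => dotp t.2.1.2.2 (t0 - t.1.2))).
      apply: dotp_pair_continuous; first exact: (fst_continuous (snd_continuous c21)).
      apply: (@continuousB _ _ _ (fun=> q) (fun t : (V * U) * (phase * R) => t.1.1)) => //.
      exact: cst_continuous.
    apply: dotp_pair_continuous; first exact: (snd_continuous (snd_continuous c21)).
    apply: (@continuousB _ _ _ (fun=> t0) (fun t : (V * U) * (phase * R) => t.1.2)) => //.
    exact: cst_continuous.
  have := cG; rewrite /continuous_at => /cvgrPdist_lt /(_ _ G0).
  apply: filterS => -[w' yc] /= hG; exists (q, t0).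
  by move: hG; rewrite ltr_norml => /andP[_ ?]; lra.
have N0 : nbhs ((x0, w0) : phase, 0 : R) (fun yc => K `<=` P yc).
  exact: (compact_near_coveringP K).1 cK _ (nbhs _) P _ near_P.
have [[A B] /= [nA /nbhs_normP[r /= r0 hB]] hAB] := N0.
have : nbhs ((x0, w0) : phase) A := nA.
rewrite nbhsE => -[A' [oA' A'0] A'A].
exists A', (r / 2); split => //; first by rewrite divr_gt0.
move=> y p u /A'A Ay pu.
have Br : B (r / 2).
  by apply: hB; rewrite /ball_/= sub0r normrN gtr0_norm; lra.
have [[q t]] := hAB (y, r / 2) (conj Ay Br) (p, u) pu.
rewrite /G/= => h.
apply: le_trans (lagrangian_ge i y.1 y.2.1 y.2.2 q t).
by rewrite lee_fin; rewrite !dotpBr in h; lra.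
Qed.

End Phase.

(** * Minimizing closed measures *)

(** Since g may have infinite integral, this covers <mu_i, L_i> before it is known
    to be finite. *)
Lemma integral_le_measurable (R : realType) d (T : measurableType d)
    (mu : {measure set T -> \bar R}) (f g : T -> \bar R) :
  mu.-integrable setT f -> measurable_fun setT g ->
  (forall x, f x <= g x)%E -> (\int[mu]_x f x <= \int[mu]_x g x)%E.
Proof.
move=> /integrableP[mf _] mg fg; rewrite integralE [leRHS]integralE leeB//.
- apply: ge0_le_integral => //.
  + exact: measurable_funepos.
  + exact: measurable_funepos.
  + by move=> x _; apply: (@funepos_le _ _ setT); rewrite ?in_setT// => y _.
- apply: ge0_le_integral => //.
  + exact: measurable_funeneg.
  + exact: measurable_funeneg.
  + by move=> x _; apply: (@funeneg_le _ _ setT); rewrite ?in_setT// => y _.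
Qed.

(** Adding e_j with j <> i to u cannot increase H_i, nor can subtracting
    (1, ..., 1): test the subgradient inequality in these directions. *)
Lemma subdifferential_Y (R : realType) n m (H : hamiltonian R n m) (i : 'I_m)
    (x : torus R n) p u w : ham_monotone H ->
  subdifferential (H i x) p u w -> Y i w.2.
Proof.
move=> mono sub; split.
  move=> j ji.
  have d0 : (delta_mx 0 j : 'rV[R]_m) 0 i = 0.
    by rewrite delta_coordE eq_sym (negbTE ji).
  have h1 := mono x p u (u + delta_mx 0 j) i.
  have h2 := sub p (u + delta_mx 0 j).
  rewrite subrr [u + _]addrC addrK in h2.
  have z1 : dotp w.1 0 = 0 by rewrite /dotp big1// => k _; rewrite mxE mulr0.
  rewrite z1 dotp_delta addr0 in h2.
  suff : H i x p (u + delta_mx 0 j) <= H i x p u by rewrite addrC in h2 *; lra.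
  apply: h1.
    have ij : (i == j) = false by rewrite eq_sym; exact: negbTE.
    move=> k; rewrite !mxE eqxx/= ij addr0 subrr.
    by rewrite opprD addrA subrr add0r oppr_le0.
  by rewrite mxE d0 addr0 subrr.
have h1 := mono x p u (u - const_mx 1) i.
have h2 := sub p (u - const_mx 1).
have z1 : dotp w.1 (p - p) = 0 by rewrite subrr /dotp big1// => k _; rewrite mxE mulr0.
have z2 : dotp w.2 (u - const_mx 1 - u) = - \sum_j w.2 0 j.
  rewrite addrAC subrr add0r /dotp -sumrN; apply: eq_bigr => j _.
  by rewrite !mxE mulrN1.
rewrite z1 z2 in h2.
suff : H i x p (u - const_mx 1) <= H i x p u by lra.
apply: h1 => [j|]; first by rewrite !mxE; lra.
by rewrite !mxE opprB addrCA subrr addr0.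
Qed.

Section Integration.
Variables (R : realType) (n m : nat) (H : hamiltonian R n m).
Local Notation V := 'rV[R]_n.
Local Notation U := 'rV[R]_m.
Local Notation phase := (torus R n * (V * U))%type.
Local Notation bphase := (borel_phase R n m).
Hypothesis H_cont : ham_continuous H.
Variables (lam C : R) (lam_gt0 : 0 < lam) (mu : measures R n m).
Hypothesis mu_moment :
  forall i, (\int[mu i]_y (enorm y.2.1 + enorm y.2.2)%:E < +oo)%E.
Implicit Types (i : 'I_m).

Definition test_integrand (psi : torus R n -> U) i (y : phase) : R :=
  dotp y.2.1 (tgrad (tcomp psi i) y.1) + dotp y.2.2 (psi y.1) + lam * psi y.1 0 i.

Lemma dotp_abs_le k (a b : 'rV[R]_k) : `|dotp a b| <= enorm a * enorm b.
Proof.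
rewrite ler_norml dotp_le_enorm andbT lerNl.
have -> : - dotp a b = dotp (-1 *: a) b.
  by rewrite /dotp -sumrN; apply: eq_bigr => j _; rewrite !mxE mulN1r mulNr.
apply: le_trans (dotp_le_enorm _ _) _.
rewrite le_eqVlt; apply/orP; left; apply/eqP; congr (_ * _).
rewrite /enorm; congr Num.sqrt; apply: eq_bigr => i _; apply: eq_bigr => j _.
by rewrite mxE mulN1r sqrrN.
Qed.

Lemma moment_continuous : continuous (fun y : phase => enorm y.2.1 + enorm y.2.2).
Proof.
move=> y; apply: (@continuousD _ _ _ (fun y : phase => enorm y.2.1)
  (fun y : phase => enorm y.2.2)).
  apply: (@continuous_comp _ _ _ (fun y : phase => y.2.1) (@enorm R 1 n)).
    by apply: fst_continuous; exact: cvg_snd.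
  exact: enorm_continuous.
apply: (@continuous_comp _ _ _ (fun y : phase => y.2.2) (@enorm R 1 m)).
  by apply: snd_continuous; exact: cvg_snd.
exact: enorm_continuous.
Qed.

Lemma moment_integrable i :
  (mu i).-integrable setT (fun y : bphase => (enorm y.2.1 + enorm y.2.2)%:E).
Proof.
apply/integrableP; split; first exact: (continuous_measurable_phase moment_continuous).
under eq_integral => y _ do rewrite gee0_abs ?lee_fin ?addr_ge0 ?enorm_ge0//.
exact: mu_moment.
Qed.

Lemma cst_integrable i (c : R) :
  (mu i).-integrable setT (fun _ : bphase => c%:E).
Proof. exact: finite_measure_integrable_cst. Qed.

Lemma tC1_continuous (f : torus R n -> R) : tC1 f -> continuous f.
Proof.
move=> [df _]; apply/quotient_continuous => y.
apply: differentiable_continuous.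
have [] := periodic_diff (tlift_periodic f) (pi_repr y) (df (\pi_(torus R n) y)).
by [].
Qed.

Lemma test_integrand_continuous psi i : tC1_vec psi ->
  continuous (test_integrand psi i).
Proof.
move=> C1 y.
have cpsi : continuous psi by apply: rV_continuous => j; exact: tC1_continuous (C1 j).
have cp : {for y, continuous (fun y : phase => psi y.1)}.
  by apply: (@continuous_comp _ _ _ (fun y : phase => y.1) psi); [exact: cvg_fst|exact: cpsi].
apply: (@continuousD _ _ _ (fun y : phase =>
  dotp y.2.1 (tgrad (tcomp psi i) y.1) + dotp y.2.2 (psi y.1))
  (fun y : phase => lam * psi y.1 0 i)).
  apply: (@continuousD _ _ _ (fun y : phase => dotp y.2.1 (tgrad (tcomp psi i) y.1))
    (fun y : phase => dotp y.2.2 (psi y.1))).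
    apply: dotp_pair_continuous; first by apply: fst_continuous; exact: cvg_snd.
    apply: (@continuous_comp _ _ _ (fun y : phase => y.1) (tgrad (tcomp psi i))).
      exact: cvg_fst.
    by have [_] := C1 i; exact.
  apply: dotp_pair_continuous; last exact: cp.
  by apply: snd_continuous; exact: cvg_snd.
apply: (@continuousM _ _ (fun=> lam) (fun y : phase => psi y.1 0 i)).
  exact: cst_continuous.
apply: (@continuous_comp _ _ _ (fun y : phase => psi y.1) (fun u : U => u 0 i)) => //.
exact: coord_continuous.
Qed.

(** The integrand is at most C (|xi| + |eta|) + lam C in absolute value. *)
Lemma test_integrand_integrable psi i : tC1_vec psi ->
  (forall x, enorm (tgrad (tcomp psi i) x) + enorm (psi x) <= C) ->
  (mu i).-integrable setT (fun y : bphase => (test_integrand psi i y)%:E).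
Proof.
move=> C1 bC.
have iM := integrableD measurableT
  (integrableZl measurableT C (moment_integrable i)) (cst_integrable i (lam * C)).
apply: (le_integrable measurableT _ _ iM).
  exact: (continuous_measurable_phase (test_integrand_continuous (i:=i) C1)).
move=> y _; rewrite -EFinM -EFinD !abse_EFin lee_fin.
have g0 := enorm_ge0 (tgrad (tcomp psi i) y.1); have u0 := enorm_ge0 (psi y.1).
have bx := bC y.1; have C0 : 0 <= C by lra.
have x0 := enorm_ge0 y.2.1; have e0 := enorm_ge0 y.2.2.
rewrite [leRHS]ger0_norm; last by rewrite addr_ge0// mulr_ge0 ?addr_ge0// ltW.
rewrite /test_integrand; apply: le_trans (ler_normD _ _) _; apply: lerD.
  apply: le_trans (ler_normD _ _) _; rewrite mulrDr; apply: lerD.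
    apply: le_trans (dotp_abs_le _ _) _; rewrite mulrC ler_wpM2r//; lra.
  apply: le_trans (dotp_abs_le _ _) _; rewrite mulrC ler_wpM2r//; lra.
rewrite normrM (gtr0_norm lam_gt0) ler_wpM2l ?(ltW lam_gt0)//.
by have := enorm_ge_coord (psi y.1) i; lra.
Qed.

Lemma indic_integrable i (A : set bphase) : measurable A ->
  (mu i).-integrable setT (fun y : bphase => (\1_A y)%:E).
Proof.
move=> mA; apply/integrableP; split; first exact/measurable_EFinP.
under eq_integral => y _ do rewrite gee0_abs ?lee_fin//.
by rewrite integral_indic// setIT -ge0_fin_numE// fin_num_measure.
Qed.

(** L_i >= test_integrand - delta everywhere, with an additional c on A when
    i = i0.  Integrating, v_k(z) >= psi_k(z) - delta |mu| + c mu_i0(A), while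
    psi_k(z) >= v_k(z) - delta; if mu_i0(A) > 0, this fails for small delta. *)
Lemma gap_set_null (v : torus R n -> U) (z : torus R n) (k i0 : 'I_m)
    (A : set phase) (c : R) :
  (forall psi : torus R n -> U, tC1_vec psi ->
     pairing mu (fun i y => (test_integrand psi i y)%:E) = (psi z 0 k)%:E) ->
  (v z 0 k)%:E = pairing mu (fun i y => lagrangian H i y.1 y.2.1 y.2.2) ->
  (forall delta : R, 0 < delta -> exists psi : torus R n -> U, [/\ tC1_vec psi,
    forall x i, enorm (tgrad (tcomp psi i) x) + enorm (psi x) <= C,
    forall x i, lam * psi x 0 i + H i x (tgrad (tcomp psi i) x) (psi x) <= delta &
    forall x i, `|psi x 0 i - v x 0 i| <= delta]) ->
  open A -> 0 < c ->
  (forall y p u, A y -> enorm p + enorm u <= C ->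
      ((c + dotp y.2.1 p + dotp y.2.2 u - H i0 y.1 p u)%:E
        <= lagrangian H i0 y.1 y.2.1 y.2.2)%E) ->
  mu i0 A = 0%E.
Proof.
move=> closed minimal approx oA c0 gap.
have mA : measurable (A : set bphase) := open_measurable_phase oA.
apply/eqP; rewrite eq_le measure_ge0 andbT leNgt; apply/negP => muA.
pose mT i := fine (mu i setT).
have mTE i : mu i setT = (mT i)%:E by rewrite fineK// fin_num_measure.
have mT0 i : 0 <= mT i by rewrite -lee_fin -mTE measure_ge0.
pose a := fine (mu i0 A).
have aE : mu i0 A = a%:E by rewrite fineK// fin_num_measure.
have a0 : 0 < a by rewrite -lte_fin -aE.
pose S := 1 + \sum_i mT i.
have S0 : 0 < S by rewrite ltr_pwDl// sumr_ge0.
(* half of the value at which delta (1 + |mu|) would reach c mu_i0(A) *)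
pose delta := c * a / (2 * S).
have delta0 : 0 < delta by rewrite divr_gt0// mulr_gt0.
have [psi [C1 bC sub close]] := approx delta delta0.
pose g i (y : bphase) : R :=
  test_integrand psi i y + (- delta + (if i == i0 then c else 0) * \1_A y).
have gL i y : ((g i y)%:E <= lagrangian H i y.1 y.2.1 y.2.2)%E.
  have s := sub y.1 i.
  have base : ((test_integrand psi i y - delta)%:E <=
      lagrangian H i y.1 y.2.1 y.2.2)%E.
    apply: le_trans (lagrangian_ge H i y.1 y.2.1 y.2.2 (tgrad (tcomp psi i) y.1) (psi y.1)).
    by rewrite lee_fin /test_integrand; lra.
  rewrite /g; case: eqP => [ii0|_]; last by rewrite mul0r addr0.
  rewrite indicE; have [yA|yA] := boolP (y \in A); last by rewrite mulr0 addr0.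
  move: yA; rewrite inE => yA; rewrite mulr1.
  have := gap y (tgrad (tcomp psi i) y.1) (psi y.1) yA (bC y.1 i).
  rewrite -ii0; apply: le_trans.
  by rewrite lee_fin /test_integrand; lra.
have ti i := test_integrand_integrable C1 (fun x => bC x i).
have ii i := integrableZl measurableT (if i == i0 then c else 0) (indic_integrable i mA).
have ki i := integrableD measurableT (cst_integrable i (- delta)) (ii i).
have gi i : (mu i).-integrable setT (fun y => (g i y)%:E).
  exact: (integrableD measurableT (ti i) (ki i)).
have Ig i : (\int[mu i]_y (g i y)%:E = \int[mu i]_y (test_integrand psi i y)%:E
    + (- delta * mT i + (if i == i0 then c * a else 0))%:E)%E.
  rewrite (integralD measurableT (ti i) (ki i)); congr (_ + _)%E.
  rewrite (integralD measurableT (cst_integrable i (- delta)) (ii i)).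
  rewrite EFinD; congr (_ + _)%E.
    by rewrite EFinM -mTE; exact: (integral_cst _ measurableT).
  rewrite (integralZl measurableT (indic_integrable i mA)) integral_indic// setIT.
  case: eqP => [->|_]; first by rewrite EFinM -aE.
  by rewrite mul0e.
have : (\sum_i \int[mu i]_y (g i y)%:E <= (v z 0 k)%:E)%E.
  rewrite minimal; apply: lee_sum => i _.
  exact: (integral_le_measurable (gi i) (lagrangian_measurable H_cont i) (gL i)).
rewrite (eq_bigr _ (fun i _ => Ig i)) big_split/=.
have := closed psi C1; rewrite /pairing => ->.
rewrite sumEFin -EFinD lee_fin big_split/= -mulr_sumr.
rewrite -big_mkcond/= big_pred1_eq.
have := close z k; rewrite ler_norml => /andP[h1 h2].
have e : delta * S = c * a / 2 by rewrite /delta; field; rewrite gt_eqF.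
rewrite /S mulrDr mulr1 in e.
have ca : 0 < c * a by rewrite mulr_gt0.
lra.
Qed.

End Integration.

Theorem theorem13 (R : realType) (n m : nat) (n_gt0 : (0 < n)%N)
  (H : hamiltonian R n m)
  (H_cont : ham_continuous H) (H_coer : ham_coercive H)
  (H_conv : ham_convex H) (H_mono : ham_monotone H)
  (z : torus R n) (k : 'I_m) (lam : R) (lam_gt0 : 0 < lam)
  (v : torus R n -> 'rV[R]_m) (v_sol : visc_solution H lam v)
  (C : R) (C_gt0 : 0 < C)
  (v_bound : torus_ae (fun x => tdifferentiable_vec v x /\
                                enorm (v x) + enorm (tjacobian v x) <= C))
  (Q : set ('rV[R]_n * 'rV[R]_m))
  (Q_compact : compact Q)
  (Q_convex : convex_set (Q : set (convex_lmodType ('rV[R]_n * 'rV[R]_m)%type)))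
  (Q_subdiff : forall (x : torus R n) (i : 'I_m) (p : 'rV[R]_n) (u : 'rV[R]_m),
     enorm p + enorm u <= C -> subdifferential (H i x) p u `<=` Q)
  (mu : measures R n m) (mu_C : in_C z k lam mu)
  (mu_min : (v z 0 k)%:E =
     pairing mu (fun i y => lagrangian H i y.1 y.2.1 y.2.2)) :
  forall i : 'I_m,
    supp (mu i) `<=` [set: torus R n] `*` (Q `&` ([set: 'rV[R]_n] `*` Y i)).
Proof.
move=> i [x0 w0] w0_supp.
case: v_sol => v_sub _; case: mu_C => [[mu_moment _] mu_closed].
have [p [u [pu sub]]] : exists p u, enorm p + enorm u <= C /\
    subdifferential (H i x0) p u w0.
  apply: contrapT => nsub.
  have [p u pu sub|A [c [oA Aw c0 gap]]] := @uniform_gap _ _ _ _ H_cont C i x0 w0.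
    by apply: nsub; exists p, u.
  have := w0_supp A oA Aw; rewrite ltNge => /negP; apply.
  rewrite le_eqVlt; apply/orP; left; apply/eqP.
  apply: (gap_set_null H_cont lam_gt0 mu_moment mu_closed mu_min _ oA c0 gap).
  exact: (smooth_subsolution lam_gt0 v_sub H_cont H_coer H_conv v_bound).
split => //; split; first exact: (Q_subdiff _ _ _ _ pu _ sub).
by split => //; exact: (subdifferential_Y H_mono sub).
Qed.
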